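(* Let $K$ be a non-archimedean local field. Every Frobenius-semisimple Weil representation $\rho$ of $W_K$ is uniquely determined (up to isomorphism) by its local polynomials $P(\rho/F,T)$, where $F$ ranges over the finite separable extensions of $K$. That is, if $\rho,\rho'$ are Frobenius-semisimple Weil representations over $K$ with $P(\rho/F,T)=P(\rho'/F,T)$ for every finite separable extension $F/K$, then $\rho\cong\rho'$.
   Context: Let $K$ be a non-archimedean local field with residue field $k$, $G_K=\mathrm{Gal}(K^{sep}/K)$, and $I_K$ its inertia subgroup. A (arithmetic) Frobenius element is any element of $G_K$ acting as $x\mapsto x^{|k|}$ on $\bar k$. The Weil group $W_K$ is the subgroup of $G_K$ of elements acting on $\bar k$ as an integral power of Frobenius; it contains $I_K$ and $W_K/I_K\cong\mathbb{Z}$ is generated by a Frobenius $\mathrm{Frob}_K$. A Weil representation is a homomorphism $\rho:W_K\to \mathrm{GL}_n(\mathbb{C})$ with $\rho(I_K)$ finite; it is Frobenius-semisimple if the image of some (equivalently any) Frobenius element is diagonalisable. The local polynomial is $P(\rho,T)=\det(1-\mathrm{Frob}_K^{-1}T\mid \rho^{I_K})$, and for a finite separable extension $F/K$, $P(\rho/F,T)=P(\rho|_{W_F},T)=\det(1-\mathrm{Frob}_F^{-1}T\mid\rho^{I_F})$.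
   Formalization: Weil representations are required to be continuous; with only ρ(I_K) finite the claim fails, e.g. over F_q((t)) distinct discontinuous characters of order p, nontrivial on every I_F, all have P(ρ/F,T)=1. *)

(* Defs.v *)
From HB Require Import structures.
From mathcomp Require Import all_boot all_order all_algebra all_field.
From mathcomp Require Import boolp classical_sets functions cardinality reals.
From mathcomp Require Export complex.

Set Implicit Arguments.
Unset Strict Implicit.
Unset Printing Implicit Defensive.

Import Order.TTheory GRing.Theory Num.Theory.

Local Open Scope classical_set_scope.
Local Open Scope ring_scope.
Local Open Scope complex_scope.
Local Open Scope card_scope.

(* For a local ring O inside a field E, given as a subset of E, [nonunits O]
   is its maximal ideal and [residue_field O] is the set of the classes x + m,
   x in O, seen as subsets of E. *)
Section ResidueField.
Variable E : fieldType.

Definition nonunits (O : set E) : set E :=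
  [set x | O x /\ (x = 0 \/ ~ O x^-1)].

Definition residue_class (O : set E) (x : E) : set E :=
  [set y | O y /\ nonunits O (y - x)].

Definition residue_field (O : set E) : set (set E) := residue_class O @` O.

End ResidueField.

Section LocalField.
Variables (K : fieldType) (v : K -> int).

(* The value of [v] at 0 is irrelevant: v(0) is read as +oo. *)
Definition val_ge (N : int) : set K := [set x | x = 0 \/ N <= v x].

Definition integers : set K := val_ge 0.

Definition val_cauchy (u : nat -> K) : Prop :=
  forall N : int, exists m0 : nat, forall m n : nat,
    (m0 <= m)%N -> (m0 <= n)%N -> val_ge N (u m - u n).

Definition val_cvg (u : nat -> K) (l : K) : Prop :=
  forall N : int, exists m0 : nat, forall m : nat,
    (m0 <= m)%N -> val_ge N (u m - l).

(* K is complete for the normalised discrete valuation v, with finite residue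
   field. *)
Record local_field : Prop := LocalField {
  valM : forall x y, x != 0 -> y != 0 -> v (x * y) = v x + v y;
  valD : forall x y, x != 0 -> y != 0 -> x + y != 0 ->
    Num.min (v x) (v y) <= v (x + y);
  val_uniformizer : exists2 p : K, p != 0 & v p = 1;
  val_complete : forall u, val_cauchy u -> exists l, val_cvg u l;
  residue_finite : finite_set (residue_field integers) }.

End LocalField.

Record separable_closure (K L : fieldType) (iota : {rmorphism K -> L}) : Prop :=
  SeparableClosure {
  sepcl_separable : forall x : L,
    exists2 p : {poly K}, separable_poly p & root (map_poly iota p) x;
  sepcl_closed : forall p : {poly L},
    separable_poly p -> (1 < size p)%N -> exists x, root p x }.

Definition integral_closure (K L : fieldType) (iota : {rmorphism K -> L})
    (O : set K) : set L :=
  [set x | exists p : {poly K},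
     [/\ p \is monic, forall k, O p`_k & root (map_poly iota p) x]].

(* Gal(L / iota K), acting on L on the left: (g * h) x = g (h x). *)
Section GaloisGroup.
Variables (K L : fieldType) (iota : {rmorphism K -> L}).

Definition field_aut (g : L -> L) : Prop :=
  [/\ {morph g : x y / x - y}, g 1 = 1 /\ {morph g : x y / x * y},
      bijective g & forall x, g (iota x) = iota x].

Record galAut := Gal { gal_fun :> L -> L; galP : field_aut gal_fun }.

Lemma gal_eqP (g h : galAut) : (forall x, g x = h x) -> g = h.
Proof.
case: g h => [g gP] [h hP] /= /funext gh; move: gP hP; rewrite gh => gP hP.
by congr Gal; exact: Prop_irrelevance.
Qed.

HB.instance Definition _ := gen_eqMixin galAut.
HB.instance Definition _ := gen_choiceMixin galAut.

Lemma gal_one_subproof : field_aut id.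
Proof. by split=> //; exists id. Qed.

Lemma gal_mul_subproof (g h : galAut) : field_aut (g \o h).
Proof.
case: g h => [g [gB [g1 gM] gbij gK]] [h [hB [h1 hM] hbij hK]] /=.
split; [|split| |] => [x y||x y||x] /=.
- by rewrite hB gB.
- by rewrite h1 g1.
- by rewrite hM gM.
- exact: bij_comp.
- by rewrite hK gK.
Qed.

Lemma gal_inv_exists (g : galAut) :
  exists h : galAut, cancel g h /\ cancel h g.
Proof.
case: g => [g [gB [g1 gM] [h gh hg] gK]] /=.
suff hP : field_aut h by exists (Gal hP).
have gI : injective g := can_inj gh.
split; [|split| |] => [x y||x y||x].
- by apply: gI; rewrite gB !hg.
- by apply: gI; rewrite g1 hg.
- by apply: gI; rewrite gM !hg.
- by exists g.
- by apply: gI; rewrite hg gK.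
Qed.

Definition gal_one : galAut := Gal gal_one_subproof.
Definition gal_mul (g h : galAut) : galAut := Gal (gal_mul_subproof g h).
Definition gal_inv (g : galAut) : galAut := sval (cid (gal_inv_exists g)).

Lemma gal_mulA : associative gal_mul.
Proof. by move=> g h k; apply: gal_eqP. Qed.

Lemma gal_mul1g : left_id gal_one gal_mul.
Proof. by move=> g; apply: gal_eqP. Qed.

Lemma gal_mulg1 : right_id gal_one gal_mul.
Proof. by move=> g; apply: gal_eqP. Qed.

Lemma gal_mulVg : left_inverse gal_one gal_inv gal_mul.
Proof.
move=> g; apply: gal_eqP => x /=.
by rewrite /gal_inv; case: cid => h [/= gh _]; exact: gh.
Qed.

Lemma gal_mulgV : right_inverse gal_one gal_inv gal_mul.
Proof.
move=> g; apply: gal_eqP => x /=.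
by rewrite /gal_inv; case: cid => h [/= _ hg]; exact: hg.
Qed.

HB.instance Definition _ :=
  isGroup.Build galAut gal_mulA gal_mul1g gal_mulg1 gal_mulVg gal_mulgV.

Lemma gal_zmod_morphism (g : galAut) : zmod_morphism g.
Proof. by case: g => g []. Qed.

Lemma gal_monoid_morphism (g : galAut) : GRing.monoid_morphism g.
Proof. by case: g => g [? [? ?]]. Qed.

HB.instance Definition _ (g : galAut) :=
  GRing.isZmodMorphism.Build L L (gal_fun g) (gal_zmod_morphism g).
HB.instance Definition _ (g : galAut) :=
  GRing.isMonoidMorphism.Build L L (gal_fun g) (gal_monoid_morphism g).

End GaloisGroup.

(* K is a field with valuation v and L a separable closure of K, embedded by
   iota. The ring [int_closure] is the valuation ring of L, and its residue
   field is the algebraic closure of the residue field of K. *)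
Section WeilGroup.
Variables (K : fieldType) (v : K -> int) (L : fieldType).
Variable iota : {rmorphism K -> L}.

Local Notation G := (galAut iota).
Local Notation OL := (integral_closure iota (integers v)).

(* g acts on the residue field of L as x |-> x ^ m *)
Definition acts_as_power (m : nat) : set G :=
  [set g | forall x, OL x -> nonunits OL (g x - x ^+ m)].

(* The groups of an extension F of K inside L, embedded by j; for K itself
   take j := iota. The valuation ring of F is the preimage of that of L. *)
Section Subextension.
Variables (F : fieldType) (j : {rmorphism F -> L}).

Definition abs_galois : set G := [set g | forall x, g (j x) = j x].

Definition residue_card (q : nat) : Prop := residue_field (j @^-1` OL) #= `I_q.

Definition frobenius : set G :=
  [set g | abs_galois g /\ exists2 q, residue_card q & acts_as_power q g].

Definition inertia : set G := abs_galois `&` acts_as_power 1.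

(* g acts as a power of x |-> x ^ q with exponent n (first case) or - n *)
Definition weil : set G :=
  [set g | abs_galois g /\ exists2 q, residue_card q & exists n : nat,
     acts_as_power (q ^ n) g \/ acts_as_power (q ^ n) (g^-1)%g].

End Subextension.

Section Representation.
Variable R : realType.
Local Notation C := R[i].

(* As for matrix representations of finite groups, a representation of the
   Weil group is a function on the ambient group G whose values outside of
   [weil iota] are irrelevant. The topology of the Weil group is the one for
   which the inertia subgroup, with its Krull topology, is open; the subgroups
   of inertia fixing a finite subset s of L are a basis of neighbourhoods
   of 1. *)
Record weil_repr (n : nat) (rho : G -> 'M[C]_n) : Prop := WeilRepr {
  weil_repr1 : rho 1%g = 1%:M;
  weil_reprM : {in weil iota &, {morph rho : g h / (g * h)%g >-> g *m h}};
  weil_repr_inertia : finite_set (rho @` inertia iota);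
  weil_repr_continuous : forall g, weil iota g -> forall eps : R, 0 < eps ->
    exists s : seq L, forall h, inertia iota h -> {in s, h =1 id} ->
      forall a b, `|rho (g * h)%g a b - rho g a b| < eps%:C }.

Definition frobenius_semisimple (n : nat) (rho : G -> 'M[C]_n) : Prop :=
  exists2 phi, frobenius iota phi & diagonalizable (rho phi).

Definition weil_iso (n m : nat) (rho : G -> 'M[C]_n) (rho' : G -> 'M[C]_m) :
    Prop :=
  exists (A : 'M[C]_(n, m)) (B : 'M[C]_(m, n)),
    [/\ A *m B = 1%:M, B *m A = 1%:M &
        forall g, weil iota g -> rho g *m A = A *m rho' g].

Section LocalPolynomial.
Variables (n : nat) (rho : G -> 'M[C]_n).

(* Column vectors, so that rho acts on the left. *)
Definition is_fixed_space (I : set G) : set {vspace 'cV[C]_n} :=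
  [set U : {vspace 'cV[C]_n} |
     forall w, w \in U <-> forall g, I g -> rho g *m w = w].

Definition fixed_space (I : set G) : {vspace 'cV[C]_n} :=
  xget 0%VS (is_fixed_space I).

Lemma fixed_spaceP (I : set G) (w : 'cV[C]_n) :
  w \in fixed_space I <-> forall g, I g -> rho g *m w = w.
Proof.
move: w; suff: is_fixed_space I (fixed_space I) by [].
apply: xgetPex.
pose fixd (w : 'cV[C]_n) := forall g, I g -> rho g *m w = w.
pose P d := `[< exists2 U : {vspace 'cV[C]_n},
  \dim U = d & forall w, w \in U -> fixd w >].
have P0 : exists d, P d.
  exists 0%N; apply/asboolP; exists 0%VS; first by rewrite dimv0.
  by move=> w; rewrite memv0 => /eqP -> g _; rewrite mulmx0.
have Pmax d : P d -> (d <= \dim {:'cV[C]_n})%N.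
  by move=> /asboolP [U <- _]; apply/dimvS/subvf.
case: (ex_maxnP P0 Pmax) => d /asboolP [U dU fixU] dmax.
exists U => w; split=> [/fixU//|fixw].
have : P (\dim (U + <[w]>)).
  apply/asboolP; exists (U + <[w]>)%VS => // x /memv_addP [y /fixU fixy].
  move=> [z /vlineP [c ->] ->] g Ig.
  by rewrite mulmxDr -scalemxAr fixy // fixw.
move=> /dmax; rewrite -dU => dimle.
have /eqP -> : U == (U + <[w]>)%VS by rewrite eqEdim addvSl.
exact: subvP (addvSr U <[w]>) _ (memv_line w).
Qed.

(* The matrix of the restriction to U of multiplication by M on column
   vectors, in the basis [vbasis U], when U is stable under M. *)
Definition restr_mx (U : {vspace 'cV[C]_n}) (M : 'M[C]_n) : 'M[C]_(\dim U) :=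
  \matrix_(a, b) coord (vbasis U) a (M *m (vbasis U)`_b).

(* The value does not depend on the choice of the Frobenius element: any two
   differ by an element of inertia. *)
Definition local_poly (F : fieldType) (j : {rmorphism F -> L}) : {poly C} :=
  let phi := xget 1%g (frobenius j) in
  \det (1%:M - 'X *: map_mx polyC
    (restr_mx (fixed_space (inertia j)) (rho phi^-1%g))).

End LocalPolynomial.

End Representation.

End WeilGroup.

(* Main.v *)
Require Import Defs.
From HB Require Import structures.
From mathcomp Require Import all_boot all_order all_fingroup all_algebra.
From mathcomp Require Import all_solvable all_field.
From mathcomp Require Import boolp classical_sets functions cardinality reals.
From mathcomp Require Import ring zify.

(* Let g in W_K act on the residue field of L as x |-> x^(q^d) with d > 0, and
   let s be a finite subset of L whose pointwise stabiliser in I_K lies in the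
   kernels of rho and rho'. Choose e > 0 such that g^e fixes s and a primitive
   root of unity zeta of order q^(de) - 1, and let F be the field fixed by g in
   a finite Galois extension of K containing s and zeta. An element of I_F
   agrees with some g^a on s and zeta; being trivial on the residue field it
   satisfies zeta^(q^(da)) = zeta, so e divides a and it fixes s. Hence I_F acts
   trivially, g is a Frobenius element of F, and
   P(rho/F, T) = det(1 - rho(g)^-1 T): the traces of rho and rho' agree on g^-1.

   It remains to see that these traces determine rho. On rho + rho', averaging
   over the finite image of inertia, over the powers Phi^a (a < m) of a
   Frobenius and over the eigenprojectors of Phi^m gives a projection
   Y |-> \sum_i A_i Y B_i onto the commutant, in which every B_i is a
   combination of elements g^-1 as above. Take an intertwiner T : rho -> rho' of
   maximal rank; it has an equivariant generalised inverse, which cuts out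
   summands of rho and rho' with equal traces and without nonzero intertwiner.
   Comparing the traces of the averaging operators shows that they vanish. *)

Set Implicit Arguments.
Unset Strict Implicit.
Unset Printing Implicit Defensive.

Import Order.TTheory GRing.Theory Num.Theory.

Local Open Scope ring_scope.
Local Open Scope complex_scope.

(** * Traces and intertwiners *)

(** In a rank factorisation [E = c *m r], idempotence cancels to [r *m c = 1], so the trace is that
    of an identity matrix of size [\rank E]. *)
Lemma mxtrace_idem (F : fieldType) n (E : 'M[F]_n) :
  E *m E = E -> \tr E = (\rank E)%:R.
Proof.
move=> EE; have := mulmx_base E; have := col_base_full E; have := row_base_free E.
move: (row_base E) (col_base E); move: (\rank E) => k r c.
case/row_freeP=> r' rr' fc cr; have [c' cc'] := row_fullP fc.
subst E; have h : r *m c = 1%:M; last by rewrite mxtrace_mulC h mxtrace1.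
have : c' *m (c *m r *m (c *m r)) *m r' = 1%:M by rewrite EE mulmxA cc' mul1mx rr'.
by rewrite !mulmxA cc' mul1mx -mulmxA rr' mulmx1.
Qed.

Lemma mxtrace_lin_mx (F : fieldType) m n (f : {linear 'M[F]_(m, n) -> 'M[F]_(m, n)}) :
  \tr (lin_mx f) = \sum_i \sum_j f (delta_mx i j) i j.
Proof.
rewrite /mxtrace (reindex _ (curry_mxvec_bij m n)) pair_bigA /=.
apply: eq_bigr => -[i j] _ /=; rewrite /lin_mx /lin1_mx mxE /=.
by rewrite -mxvec_delta mxvecK mxvecE.
Qed.

(** Read through [mxtrace_lin_mx], the left side is the trace of the operator [Y |-> A Y B]. *)
Lemma mxtrace_sandwich (F : fieldType) n (A B : 'M[F]_n) :
  \sum_i \sum_j (A *m delta_mx i j *m B) i j = \tr A * \tr B.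
Proof.
rewrite /mxtrace mulr_suml; apply: eq_bigr => i _; rewrite mulr_sumr.
apply: eq_bigr => j _.
rewrite -[delta_mx i j](mul_delta_mx (0 : 'I_1)) mulmxA -mulmxA -colE -rowE.
by rewrite !mxE big_ord1 !mxE.
Qed.

Section SeparabilityElement.
Variables (C : numFieldType) (N : nat) (S : 'M[C]_N -> Prop).

Definition commutant (X : 'M[C]_N) := forall s, S s -> s *m X = X *m s.

Lemma commutantM X Y : commutant X -> commutant Y -> commutant (X *m Y).
Proof. by move=> cX cY s Ss; rewrite mulmxA cX // -mulmxA cY // mulmxA. Qed.

Lemma commutantB X Y : commutant X -> commutant Y -> commutant (X - Y).
Proof. by move=> cX cY s Ss; rewrite mulmxBr mulmxBl cX // cY. Qed.

Lemma commutantD X Y : commutant X -> commutant Y -> commutant (X + Y).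
Proof. by move=> cX cY s Ss; rewrite mulmxDr mulmxDl cX // cY. Qed.

Variables (I : finType) (A B : I -> 'M[C]_N).
Hypothesis hA : forall i X, commutant X -> A i *m X = X *m A i.
Hypothesis hB : forall i X, commutant X -> B i *m X = X *m B i.
Hypothesis h1 : \sum_i A i *m B i = 1%:M.

(** For a finite group one would take the pairs [g / |G|], [g^-1], which form the separability
    idempotent of the group algebra. In general [hA] and [hB] place the coefficients in the
    bicommutant of [S]. *)
Definition reynolds (Y : 'M[C]_N) := \sum_i A i *m Y *m B i.
Hypothesis hR : forall Y, commutant (reynolds Y).

Lemma reynolds_id X Y Z : commutant X -> commutant Z ->
  X *m reynolds Y *m Z = reynolds (X *m Y *m Z).
Proof.
move=> cX cZ; rewrite /reynolds mulmx_sumr mulmx_suml; apply: eq_bigr => i _.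
by rewrite -!mulmxA hB // !mulmxA hA.
Qed.

Lemma reynolds_commutant X : commutant X -> reynolds X = X.
Proof.
move=> cX; rewrite -[RHS]mulmx1 -h1 mulmx_sumr; apply: eq_bigr => i _.
by rewrite mulmxA hA.
Qed.

Lemma reynolds_is_linear (e f : 'M[C]_N) :
  linear (fun Y : 'M[C]_N => e *m reynolds Y *m f).
Proof.
move=> a X Y; rewrite /reynolds scalemxAl -mulmxDl; congr (_ *m _).
rewrite scalemxAr -mulmxDr scaler_sumr -big_split /=; congr (_ *m _).
by apply: eq_bigr => i _; rewrite mulmxDr mulmxDl -scalemxAr -scalemxAl.
Qed.

(* [Y |-> e (reynolds Y) f] has trace [\sum_i tr (A_i e) tr (B_i f)]; replacing
   f by e turns it into an idempotent operator fixing e, of nonzero trace. *)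
Lemma commutant_corner_neq0 e f : commutant e -> commutant f ->
  e *m e = e -> (forall i, \tr (B i *m e) = \tr (B i *m f)) -> e != 0 ->
  exists2 X, commutant X & e *m X *m f != 0.
Proof.
move=> ce cf ee tr_ef e0; apply: contrapT => none.
have ef0 Y : e *m reynolds Y *m f = 0.
  by apply: contrapT => /eqP h; apply: none; exists (reynolds Y).
have op_tr g : \sum_i \sum_j (e *m reynolds (delta_mx i j) *m g) i j =
    \sum_k \tr (e *m A k) * \tr (B k *m g).
  under [RHS]eq_bigr do rewrite -mxtrace_sandwich.
  rewrite [RHS]exchange_big; apply: eq_bigr => i _ /=.
  rewrite [RHS]exchange_big; apply: eq_bigr => j _ /=.
  rewrite /reynolds mulmx_sumr mulmx_suml summxE.
  by apply: eq_bigr => k _; rewrite !mulmxA.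
pose opL := fun Y => e *m reynolds Y *m e.
pose opM := GRing.isLinear.Build _ _ _ _ opL (reynolds_is_linear e e).
pose op : {linear 'M[C]_N -> 'M[C]_N} := HB.pack opL opM.
have op0 : \tr (lin_mx op) = 0.
  rewrite mxtrace_lin_mx (op_tr e).
  under eq_bigr do rewrite tr_ef.
  by rewrite -op_tr big1 // => i _; rewrite big1 // => j _; rewrite ef0 mxE.
have opid : lin_mx op *m lin_mx op = lin_mx op.
  apply/row_matrixP => i; rewrite !rowE mulmxA.
  rewrite -[delta_mx 0 i]vec_mxK !mul_vec_lin; congr mxvec; set Y := vec_mx _.
  change (e *m reynolds (opL Y) *m e = opL Y); rewrite (@reynolds_commutant (opL Y)).
    by rewrite /opL !mulmxA ee -!mulmxA ee.
  by rewrite /opL; apply: commutantM => //; apply: commutantM.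
(* In characteristic 0 an idempotent of trace 0 has rank 0. *)
move: op0; rewrite mxtrace_idem // => /eqP; rewrite pnatr_eq0 mxrank_eq0 => /eqP op0.
have : op e = 0 by rewrite -[op e]mxvecK -mul_vec_lin op0 mulmx0 linear0.
rewrite /= /opL reynolds_commutant // ee ee => e00.
by rewrite e00 eqxx in e0.
Qed.

(** [T] has maximal rank among the [p X p'] in the commutant; [e] and [f] are what it leaves
    uncovered in [p] and [p']. A nonzero [X'] of the form [e X f] in the commutant would make the
    rank of [T + X'] larger, so [commutant_corner_neq0] forces [e = 0], and equality of traces gives
    [f = 0]. *)
Lemma commutant_equiv p p' : commutant p -> commutant p' ->
  p *m p = p -> p' *m p' = p' -> \tr p = \tr p' ->
  (forall i, \tr (B i *m p) = \tr (B i *m p')) ->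
  exists T T', [/\ commutant T, commutant T', T *m T' = p, T' *m T = p' &
    p *m T *m p' = T /\ p' *m T' *m p = T'].
Proof.
move=> cp cp' pp pp' tr1 trB.
pose P k := `[< exists T, [/\ commutant T, p *m T *m p' = T & \rank T = k] >].
have P0 : exists k, P k.
  exists 0%N; apply/asboolP; exists 0; split; rewrite ?mulmx0 ?mul0mx ?mxrank0 //.
  by move=> s _; rewrite mulmx0 mul0mx.
have Pmax k : P k -> (k <= N)%N by move=> /asboolP[T [_ _ <-]]; exact: rank_leq_row.
case: (ex_maxnP P0 Pmax) => k /asboolP[T [cT pT rT]] Tmax.
(* Averaging keeps the pseudo-inverse a generalised inverse: as [T] is in the commutant, [T
   (reynolds (pinvmx T)) T = reynolds (T (pinvmx T) T) = T]. *)
pose T' := p' *m reynolds (pinvmx T) *m p.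
have cT' : commutant T' by apply: commutantM => //; apply: commutantM.
have pTl : p *m T = T by rewrite -pT !mulmxA pp.
have pTr : T *m p' = T by rewrite -pT -!mulmxA pp'.
have pT'l : p' *m T' = T' by rewrite /T' !mulmxA pp'.
have pT'r : T' *m p = T' by rewrite /T' -!mulmxA pp.
have TT'T : T *m T' *m T = T.
  have -> : T *m T' *m T = T *m reynolds (pinvmx T) *m T.
    by rewrite /T' -!mulmxA pTl !mulmxA pTr.
  by rewrite reynolds_id // mulmxKpV // reynolds_commutant.
move: T' cT' pT'l pT'r TT'T => T' cT' pT'l pT'r TT'T.
pose e := p - T *m T'; pose f := p' - T' *m T.
have ce : commutant e by apply: commutantB => //; apply: commutantM.
have cf : commutant f by apply: commutantB => //; apply: commutantM.
have ee : e *m e = e.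
  rewrite /e mulmxBr !mulmxBl pp -(mulmxA T T' p) pT'r mulmxA pTl.
  by rewrite mulmxA TT'T subrr subr0.
have ff : f *m f = f.
  rewrite /f mulmxBr !mulmxBl pp' -(mulmxA T' T p') pTr mulmxA pT'l.
  by rewrite -!mulmxA [T *m (T' *m T)]mulmxA TT'T subrr subr0.
(* [B i] commutes with [T], so the removed parts [T T'] and [T' T] have the same trace against
   it. *)
have tr_ef i : \tr (B i *m e) = \tr (B i *m f).
  rewrite /e /f !mulmxBr !linearB /= trB; congr (_ - _).
  by rewrite mulmxA hB // -mulmxA mxtrace_mulC -mulmxA.
have tre : \tr e = \tr f by rewrite /e /f !linearB /= tr1 (mxtrace_mulC T).
have TT'e : T *m T' *m e = 0.
  by rewrite /e mulmxBr -(mulmxA T T' p) pT'r !mulmxA TT'T subrr.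
have eT : e *m T = 0 by rewrite /e mulmxBl pTl TT'T subrr.
have Tf : T *m f = 0 by rewrite /f mulmxBr pTr mulmxA TT'T subrr.
have pe : p *m e = e by rewrite /e mulmxBr pp mulmxA pTl.
have fp' : f *m p' = f by rewrite /f mulmxBl pp' -mulmxA pTr.
have e0 : e = 0.
  apply: contrapT => /eqP e0.
  have [X cX X0] := commutant_corner_neq0 ce cf ee tr_ef e0.
  have cX' : commutant (e *m X *m f) by apply: commutantM => //; apply: commutantM.
  have eX' : e *m (e *m X *m f) = e *m X *m f by rewrite !mulmxA ee.
  have pX' : p *m (e *m X *m f) = e *m X *m f by rewrite !mulmxA pe.
  have X'p : e *m X *m f *m p' = e *m X *m f by rewrite -mulmxA fp'.
  have Xf : e *m X *m f *m f = e *m X *m f by rewrite -mulmxA ff.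
  have TX : T *m T' *m (T + e *m X *m f) = T.
    by rewrite mulmxDr TT'T !mulmxA TT'e !mul0mx addr0.
  move: (e *m X *m f) X0 cX' eX' pX' X'p Xf TX => X' X'0 cX' eX' pX' X'p X'f TX.
  have eTX : e *m (T + X') = X' by rewrite mulmxDr eT add0r.
  (* Right multiplication by [f] is the identity on the row space of [X'] and kills that of [T]. *)
  have dis : (T :&: X' = 0)%MS.
    apply/eqP/rowV0P => u; rewrite sub_capmx => /andP[/submxP[a ua] /submxP[b ub]].
    by rewrite ub -X'f mulmxA -ub ua -mulmxA Tf mulmx0.
  (* Left multiplication by [T T'] and by [e] extracts [T] and [X'] from [T + X'], whose row space
     therefore contains both of theirs. *)
  have le : (\rank T + \rank X' <= \rank (T + X')%R)%N.
    rewrite -mxrank_disjoint_sum //; apply: mxrankS; rewrite addsmx_sub; apply/andP; split.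
      by rewrite -{1}TX submxMl.
    by rewrite -{1}eTX submxMl.
  have : P (\rank (T + X')%R).
    apply/asboolP; exists (T + X'); split=> //; first exact: commutantD.
    by rewrite mulmxDr mulmxDl pT pX' X'p.
  move=> /Tmax; rewrite -rT leqNgt (leq_trans _ le) // -[X in (X < _)%N]addn0 ltn_add2l.
  by rewrite lt0n mxrank_eq0.
have f0 : f = 0.
  move: tre; rewrite e0 linear0 mxtrace_idem // => /esym/eqP.
  by rewrite pnatr_eq0 mxrank_eq0 => /eqP.
exists T, T'; split=> //.
- by apply/esym/subr0_eq.
- by apply/esym/subr0_eq.
- by split=> //; rewrite pT'l pT'r.
Qed.

End SeparabilityElement.

(** * Averaging over finite-by-cyclic groups of matrices *)

Lemma exprMV (R : pzSemiRingType) (x y : R) a : x * y = 1 -> x ^+ a * y ^+ a = 1.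
Proof.
move=> xy; elim: a => [|a IH]; first by rewrite !expr0 mulr1.
by rewrite exprSr exprS mulrA -(mulrA (x ^+ a)) xy mulr1.
Qed.

Section FiniteByCyclic.
Variables (C : numFieldType) (N : nat) (U : seq 'M[C]_N) (Phi Phi' : 'M[C]_N).
Hypothesis PhiV : Phi * Phi' = 1.
Hypothesis VPhi : Phi' * Phi = 1.
Hypothesis U1 : 1 \in U.
Hypothesis UM : forall u w, u \in U -> w \in U -> u * w \in U.
Hypothesis UV : forall u, u \in U -> exists2 w, w \in U & u * w = 1 /\ w * u = 1.
Hypothesis UJ : forall u, u \in U -> Phi * u * Phi' \in U.
Variables (m : nat) (P P' : 'M[C]_N) (d : 'rV[C]_N).
Hypothesis m_gt0 : (0 < m)%N.
Hypothesis PV : P * P' = 1.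
Hypothesis VP : P' * P = 1.
Hypothesis PhiX : Phi ^+ m = P' * diag_mx d * P.

Let scAl a (X Y : 'M[C]_N) : a *: (X * Y) = a *: X * Y.
Proof. exact: scalemxAl. Qed.

Let scAr a (X Y : 'M[C]_N) : a *: (X * Y) = X * (a *: Y).
Proof. exact: scalemxAr. Qed.

Let d_neq0 i : d 0 i != 0.
Proof.
apply/eqP => di0.
have h : diag_mx d * (P * Phi' ^+ m * P') = 1.
  transitivity (P * (P' * diag_mx d * P) * Phi' ^+ m * P').
    by rewrite !mulrA PV mul1r.
  by rewrite -PhiX -(mulrA P) exprMV // mulr1 PV.
move: (congr1 (fun M : 'M[C]_N => M i i) h); rewrite /= -mulmxE mul_diag_mx !mxE di0 mul0r eqxx.
by move=> /esym/eqP; rewrite oner_eq0.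
Qed.

Let ev := undup (codom (d 0)).
Let Z := Phi ^+ m.

(* The root at 0 makes the eigenprojectors [E l] combinations of strictly positive
   powers of [Phi]. *)
Let lag (l : C) : {poly C} :=
  \prod_(x <- rem l (0 :: ev)) ((l - x)^-1 *: ('X - x%:P)).

Let lag_eval l i : l \in ev -> (lag l).[d 0 i] = (d 0 i == l)%:R.
Proof.
move=> lev; rewrite /lag horner_prod.
have u0 : uniq (0 :: ev).
  rewrite /= undup_uniq andbT mem_undup; apply/negP => /codomP[j /esym/eqP].
  by rewrite (negPf (d_neq0 j)).
have hmem x : (x \in rem l (0 :: ev)) = (x != l) && (x \in 0 :: ev).
  by rewrite (mem_rem_uniq _ u0).
have [dil|dil] := eqVneq (d 0 i) l.
  rewrite big_seq big1 // => x; rewrite hmem => /andP[xl _].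
  by rewrite dil !hornerE mulVf // subr_eq0 eq_sym.
have din : d 0 i \in rem l (0 :: ev).
  by rewrite hmem dil in_cons mem_undup codom_f orbT.
by rewrite (big_rem _ din) /= !hornerE subrr mulr0 mul0r.
Qed.

Let lag_0 l : l \in ev -> (lag l)`_0 = 0.
Proof.
move=> lev; rewrite -horner_coef0 /lag horner_prod.
have l0 : 0 != l.
  by move: lev; rewrite mem_undup => /codomP[j ->]; rewrite eq_sym d_neq0.
have zin : 0 \in rem l (0 :: ev) by rewrite /= (negPf l0) mem_head.
by rewrite (big_rem _ zin) /= hornerZ hornerXsubC subrr mulr0 mul0r.
Qed.

Let E l := \sum_(k < size (lag l)) (lag l)`_k *: Z ^+ k.

Let E_diag l : l \in ev -> E l = P' * diag_mx (\row_i (d 0 i == l)%:R) * P.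
Proof.
move=> lev.
have Zk k : Z ^+ k = P' * diag_mx (\row_i d 0 i ^+ k) * P.
  elim: k => [|k IH].
    rewrite expr0 (_ : diag_mx _ = 1) ?mulr1 ?VP //.
    by apply/matrixP => i j; rewrite !mxE expr0.
  rewrite exprSr IH /Z PhiX !mulrA -(mulrA _ P) PV mulr1 -(mulrA P' (diag_mx _) (diag_mx _)).
  congr (_ * _ * _); rewrite -mulmxE mulmx_diag; congr diag_mx.
  by apply/rowP => i; rewrite !mxE exprSr.
rewrite /E; under eq_bigr do rewrite Zk scAl scAr.
rewrite -mulr_suml -mulr_sumr; congr (_ * _ * _).
apply/matrixP => i j; rewrite summxE !mxE -lag_eval // horner_coef -sumrMnl.
by apply: eq_bigr => k _; rewrite !mxE mulrnAr.
Qed.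

Let E_idem l : l \in ev -> E l * E l = E l.
Proof.
move=> lev; rewrite E_diag // !mulrA -(mulrA _ P) PV mulr1 -(mulrA P' (diag_mx _) (diag_mx _)).
congr (_ * _ * _); rewrite -mulmxE mulmx_diag; congr diag_mx.
by apply/rowP => i; rewrite !mxE -natrM mulnb andbb.
Qed.

Let E_sum : \sum_(l : seq_sub ev) E (ssval l) = 1.
Proof.
under eq_bigr => l _ do rewrite E_diag ?ssvalP //.
rewrite -mulr_suml -mulr_sumr; transitivity (P' * 1 * P); last by rewrite mulr1.
congr (_ * _ * _).
apply/matrixP => i j; rewrite summxE !mxE.
have dev : d 0 i \in ev by rewrite mem_undup codom_f.
rewrite (bigD1 (SeqSub dev)) //= !mxE eqxx big1 ?addr0 // => l /eqP ll.
rewrite !mxE; case: eqP => [dl|]; last by rewrite mulr0n mul0rn.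
by case: ll; apply: val_inj; exact/esym.
Qed.

Let ZE l : l \in ev -> Z * E l = l *: E l.
Proof.
move=> lev; rewrite E_diag // /Z PhiX !mulrA -(mulrA _ P) PV mulr1 -(mulrA P' (diag_mx _)
    (diag_mx _)).
rewrite scAl scAr; congr (_ * _ * _); rewrite -mulmxE mulmx_diag.
apply/matrixP => i j; rewrite !mxE; have [->|_] := eqVneq (d 0 i) l.
  by rewrite -mulrnAr.
by rewrite mulr0n mulr0 mul0rn mulr0.
Qed.

Let EZ l : E l * Z = Z * E l.
Proof.
rewrite /E mulr_suml mulr_sumr; apply: eq_bigr => k _.
by rewrite -scAl -scAr -exprSr -exprS.
Qed.

(** The sum over [l] cuts [Y] into its diagonal blocks for the eigenspaces of [Z], which makes it
    commute with [Z]. The sum over [a] then averages, up to the factor [m], over conjugation by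
    [Phi] modulo [Z]. *)
Let W Y := \sum_(a < m) \sum_(l : seq_sub ev)
  Phi ^+ a * E (ssval l) * Y * (E (ssval l) * Phi' ^+ a).

(** Conjugation by [Phi] moves the term [a] to [a + 1]. The new term [a = m] is the old term
    [a = 0], because [Z = Phi ^+ m] commutes with [W0]. *)
Let W_conj Y : Phi * W Y * Phi' = W Y.
Proof.
pose W0 := \sum_(l : seq_sub ev) E (ssval l) * Y * E (ssval l).
have WE : W Y = \sum_(a < m) Phi ^+ a * W0 * Phi' ^+ a.
  apply: eq_bigr => a _; rewrite /W0 mulr_sumr mulr_suml.
  by apply: eq_bigr => l _; rewrite !mulrA.
have ZW0 : Phi ^+ m * W0 * Phi' ^+ m = W0.
  have zw : Z * W0 = W0 * Z.
    rewrite /W0 mulr_sumr mulr_suml; apply: eq_bigr => l _.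
    by rewrite -[RHS]mulrA EZ !mulrA ZE ?ssvalP // -!mulrA ZE ?ssvalP // -!(scAl, scAr).
  by rewrite -/Z zw -mulrA exprMV // mulr1.
rewrite WE mulr_sumr mulr_suml.
case: (m) m_gt0 ZW0 => // k _ ZW0.
rewrite big_ord_recr [RHS]big_ord_recl /= addrC; congr (_ + _).
  rewrite !expr0 mul1r mulr1 -[RHS]ZW0 exprS exprSr.
  by rewrite !mulrA.
by apply: eq_bigr => i _; rewrite /= /bump /= add1n exprS [Phi' ^+ _.+1]exprSr !mulrA.
Qed.

Let inv (u : seq_sub U) : 'M[C]_N := sval (cid2 (UV (ssvalP u))).
Let inv_in u : inv u \in U. Proof. by rewrite /inv; case: cid2. Qed.
Let invr u : ssval u * inv u = 1. Proof. by rewrite /inv; case: cid2 => w /= _ []. Qed.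
Let invl u : inv u * ssval u = 1. Proof. by rewrite /inv; case: cid2 => w /= _ []. Qed.

Let inv_uniq u w : ssval u * w = 1 -> w = inv u.
Proof. by move=> uw; rewrite -[w]mul1r -(invl u) -mulrA uw mulr1. Qed.

Let c : C := ((#|{: seq_sub U}| * m)%:R)^-1.

Let I : finType := (seq_sub U * ('I_m * seq_sub ev))%type.
Let A (i : I) := c *: (ssval i.1 * (Phi ^+ i.2.1 * E (ssval i.2.2))).
(** Only the [Z ^+ k] with [k > 0] occur in [E], and the exponent of [Phi'] is less than [m]; so
    [B i] involves only strictly positive powers of [Phi], the ones on which traces will be
    known. *)
Let B (i : I) := E (ssval i.2.2) * Phi' ^+ i.2.1 * inv i.1.

Let reynoldsE Y : reynolds A B Y = c *: \sum_(u : seq_sub U) ssval u * W Y * inv u.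
Proof.
rewrite scaler_sumr /reynolds -(pair_bigA _ (fun u x => A (u, x) *m Y *m B (u, x))) /=.
apply: eq_bigr => u _; rewrite /W mulr_sumr mulr_suml scaler_sumr.
rewrite -(pair_bigA _ (fun a l => A (u, (a, l)) *m Y *m B (u, (a, l)))) /=.
apply: eq_bigr => a _; rewrite mulr_sumr mulr_suml scaler_sumr.
by apply: eq_bigr => l _; rewrite /A /B /= !mulmxE -!scAl !mulrA.
Qed.

Let S X := X = Phi \/ X \in U.

(** Left translation by an element of [U] permutes [U]; conjugation by [Phi] permutes [U] and fixes
    [W Y]. Either way the sum over [u] is merely reindexed. *)
Let reynolds_comm Y : commutant S (reynolds A B Y).
Proof.
rewrite reynoldsE => s Ss; rewrite !mulmxE -scAl -scAr; congr (_ *: _).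
case: Ss => [->|sU]; last first.
  pose f (u : seq_sub U) := SeqSub (UM sU (ssvalP u)).
  have [s' s'U [ss' s's]] := UV sU.
  have finj : injective f.
    move=> u w /(congr1 val) /= h; apply: val_inj.
    by rewrite /= -[ssval u]mul1r -s's -mulrA h mulrA s's mul1r.
  rewrite [in RHS](reindex_inj finj) /= mulr_sumr mulr_suml; apply: eq_bigr => u _.
  rewrite (_ : inv (f u) = inv u * s') ?mulrA; last first.
    apply/esym/inv_uniq; rewrite /= -mulrA (mulrA (ssval u)) invr mul1r //.
  by rewrite -(mulrA _ s') s's mulr1.
pose f (u : seq_sub U) := SeqSub (UJ (ssvalP u)).
have finj : injective f.
  move=> u w /(congr1 val) /= h; apply: val_inj => /=.
  rewrite -[ssval u]mul1r -[ssval w]mul1r -VPhi -[Phi' * Phi * _]mulr1 -[in RHS](mulr1 (_ *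
    ssval w)) -VPhi.
  by rewrite !mulrA -!(mulrA Phi') h.
rewrite [in RHS](reindex_inj finj) /= mulr_sumr mulr_suml; apply: eq_bigr => u _.
rewrite (_ : inv (f u) = Phi * inv u * Phi'); last first.
  apply/esym/inv_uniq; rewrite /= !mulrA -(mulrA _ Phi') VPhi mulr1.
  by rewrite -(mulrA Phi) invr mulr1 PhiV.
rewrite -[in RHS](W_conj Y) !mulrA.
by rewrite -!(mulrA _ Phi' Phi) VPhi !mulr1.
Qed.

Let AB1 : \sum_i A i *m B i = 1%:M.
Proof.
have := reynoldsE 1; rewrite /reynolds.
under [in X in X = _ -> _]eq_bigr do rewrite mulmx1.
move=> ->.
have W1 : W 1 = m%:R.
  rewrite /W (eq_bigr (fun=> 1)); first by rewrite sumr_const card_ord.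
  move=> a _; rewrite -[RHS](exprMV a PhiV) -[Phi ^+ a in RHS]mulr1 -[in RHS]E_sum.
  rewrite mulr_sumr mulr_suml; apply: eq_bigr => l _.
  by rewrite mulr1 mulrA -(mulrA (Phi ^+ a)) E_idem ?ssvalP.
rewrite (eq_bigr (fun=> m%:R)); last first.
  by move=> u _; rewrite W1 mulr_natr mulrnAl invr.
rewrite sumr_const -mulrnA -[X in _ *: X]scaler_nat scalerA mulnC mulVf ?scale1r //.
rewrite pnatr_eq0 -lt0n muln_gt0 m_gt0 andbT; apply/card_gt0P.
by exists (SeqSub U1).
Qed.

Section Commuting.
Variable X : 'M[C]_N.
Hypothesis cX : commutant S X.

Let cPhi : GRing.comm X Phi.
Proof. by rewrite /GRing.comm -!mulmxE cX //; left. Qed.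

Let cPhi' : GRing.comm X Phi'.
Proof.
by rewrite /GRing.comm -[LHS]mul1r -VPhi -!mulrA (mulrA Phi) -cPhi -mulrA PhiV mulr1.
Qed.

Let cU u : u \in U -> GRing.comm X u.
Proof. by move=> uU; rewrite /GRing.comm -!mulmxE cX //; right. Qed.

Let cE l : GRing.comm X (E l).
Proof.
apply: commr_sum => k _; rewrite /GRing.comm -scAr -scAl; congr (_ *: _).
by do 2!apply: commrX.
Qed.

Fact finite_by_cyclic_coefl i : A i *m X = X *m A i.
Proof.
rewrite /A !mulmxE -scAl -scAr; congr (_ *: _); apply/esym/commrM.
  exact/cU/ssvalP.
by apply: commrM => //; exact: commrX.
Qed.

Fact finite_by_cyclic_coefr i : B i *m X = X *m B i.
Proof.
apply/esym/commrM; last exact/cU/inv_in.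
by apply: commrM => //; exact: commrX.
Qed.
End Commuting.

Lemma finite_by_cyclic_equiv p p' :
  p * p = p -> p' * p' = p' ->
  Phi * p = p * Phi -> Phi * p' = p' * Phi ->
  {in U, forall u, u * p = p * u} -> {in U, forall u, u * p' = p' * u} ->
  (forall k u, (0 < k)%N -> u \in U ->
     \tr (Phi ^+ k * u * p) = \tr (Phi ^+ k * u * p')) ->
  exists T T', [/\ (Phi * T = T * Phi /\ Phi * T' = T' * Phi),
    {in U, forall u, u * T = T * u /\ u * T' = T' * u},
    T * T' = p, T' * T = p' & p * T * p' = T /\ p' * T' * p = T'].
Proof.
move=> pp pp' Pp Pp' Up Up' tr_pp'.
have cp : commutant S p by move=> s [->|/Up].
have cp' : commutant S p' by move=> s [->|/Up'].
have trE l a u : l \in ev -> (a < m)%N -> u \in U ->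
    \tr (E l * Phi' ^+ a * u * p) = \tr (E l * Phi' ^+ a * u * p').
  move=> lev am uU; rewrite /E !mulr_suml !raddf_sum; apply: eq_bigr => k _.
  rewrite /= -!scAl !linearZ /=; case: k => -[|k] klt /=.
    by rewrite lag_0 // !mul0r.
  (* As [a < m <= m * k.+1], the factor [Phi' ^+ a] is absorbed and a strictly positive power of
     [Phi] remains. *)
  congr (_ * _); have ak : (a <= m * k.+1)%N.
    by rewrite (leq_trans (ltnW am)) // leq_pmulr.
  have -> : Z ^+ k.+1 * Phi' ^+ a = Phi ^+ (m * k.+1 - a).
    by rewrite -exprM -{1}(subnK ak) exprD -mulrA exprMV ?mulr1.
  by apply: tr_pp' => //; rewrite subn_gt0 (leq_trans am) // leq_pmulr.
(* The exponent 0 is outside the hypothesis on traces, but 1 is the sum of the eigenprojectors,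
   which are combinations of positive powers. *)
have tr1 : \tr p = \tr p'.
  rewrite -[p]mul1r -[p']mul1r -E_sum !mulr_suml !raddf_sum; apply: eq_bigr => l _ /=.
  by have := trE _ 0%N _ (ssvalP l) m_gt0 U1; rewrite expr0 !mulr1.
have trB i : \tr (B i *m p) = \tr (B i *m p').
  by case: i => u [a l]; apply: trE; [exact: ssvalP|exact: ltn_ord|exact: inv_in].
have [T [T' [cT cT' TT' T'T [e1 e2]]]] :=
  commutant_equiv (fun i X cX => finite_by_cyclic_coefl cX i) (fun i X cX =>
    finite_by_cyclic_coefr cX i) AB1 reynolds_comm
    cp cp' pp pp' tr1 trB.
exists T, T'; split=> //; first by split; [apply: cT; left|apply: cT'; left].
by move=> u uU; split; [apply: cT; right|apply: cT'; right].
Qed.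

End FiniteByCyclic.

(** * Traces as coefficients of local polynomials *)

Lemma coef1_prod_linear (F : comNzRingType) (I : finType) (a : I -> F) :
  (\prod_i (1 - a i *: 'X))`_1 = - \sum_i a i.
Proof.
suff [h0 h1] : (\prod_i (1 - a i *: 'X))`_0 = 1 /\
    (\prod_i (1 - a i *: 'X))`_1 = - \sum_i a i by [].
apply: (big_rec2 (fun (x : {poly F}) y => x`_0 = 1 /\ x`_1 = - y)).
  by rewrite !coef1 oppr0.
move=> i y1 y2 _ [h0 h1]; rewrite !mulrBl !mul1r !coefB -!scalerAl !coefZ !coefXM /=.
by rewrite h0 h1 mulr0 subr0 mulr1 opprD addrC.
Qed.

(** This is the shape of a Leibniz term once the factors at two moved indices are extracted. *)
Lemma coef1_mulXX (F : comNzRingType) (x a b r : {poly F}) :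
  (x * (- ('X * a) * (- ('X * b) * r)))`_1 = 0.
Proof.
have -> : x * (- ('X * a) * (- ('X * b) * r)) = x * a * b * r * 'X * 'X by ring.
by rewrite !coefMX.
Qed.

(** In the Leibniz expansion a permutation other than 1 moves some [i], hence also [s i]. These two
    off-diagonal entries make its term divisible by ['X ^+ 2], so the diagonal alone contributes. *)
Lemma coef1_det_linear (F : comNzRingType) n (M : 'M[F]_n) :
  (\det (1%:M - 'X *: map_mx polyC M))`_1 = - \tr M.
Proof.
rewrite /determinant (bigD1 (1%g : {perm 'I_n})) //= odd_perm1 expr0 mul1r coefD.
rewrite [X in _ + X](_ : _ = 0) ?addr0.
  rewrite /mxtrace -(coef1_prod_linear (fun i => M i i)); congr ((polyseq _)`_1);
    apply: eq_bigr => i _.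
  by rewrite !mxE perm1 eqxx mulrC mul_polyC.
rewrite coef_sum big1 // => s s1.
have [i si] : exists i, s i != i.
  apply/existsP; apply: contraNT s1; rewrite negb_exists => /forallP h.
  by apply/eqP/permP => i; rewrite perm1; apply/eqP; have := h i; rewrite negbK.
have ssi : s (s i) != s i by rewrite (inj_eq perm_inj).
rewrite (bigD1 i) //= (bigD1 (s i)) //= !mxE.
move: si ssi; rewrite eq_sym [s (s i) == _]eq_sym => si ssi.
rewrite (negPf si) (negPf ssi) !mulr0n !sub0r.
exact: coef1_mulXX.
Qed.

(** The size [\dim U] equals [n] only propositionally, so the bases are compared by rectangular
    matrices [B] and [D] with [B *m D = 1], and cyclicity of the trace concludes. *)
Lemma mxtrace_restr_mx (R : realType) n (U : {vspace 'cV[R[i]]_n}) (M : 'M[R[i]]_n) :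
  U = fullv -> \tr (restr_mx U M) = \tr M.
Proof.
move=> Uf; pose b := vbasis U.
pose B : 'M[R[i]]_(n, \dim U) := \matrix_(i, k) (b`_k) i 0.
pose D : 'M[R[i]]_(\dim U, n) := \matrix_(k, i) coord b k (delta_mx i 0).
have BD : B *m D = 1%:M.
  apply/matrixP => i j; rewrite !mxE.
  have jU : delta_mx j 0 \in U by rewrite Uf memvf.
  have := congr1 (fun v : 'cV_n => v i 0) (coord_vbasis jU); rewrite mxE eqxx andbT => ->.
  by rewrite summxE; apply: eq_bigr => k _; rewrite !mxE mulrC.
suff -> : restr_mx U M = D *m M *m B by rewrite mxtrace_mulC mulmxA BD mul1mx.
apply/matrixP => k l; rewrite mxE.
have {1}-> : b`_l = col l B by apply/colP => i; rewrite !mxE.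
rewrite -mulmxA colE mulmxA -colE; move: (M *m B) => MB.
rewrite [col _ _]matrix_sum_delta linear_sum mxE /=.
by apply: eq_bigr => i _; rewrite big_ord1 linearZ /= !mxE mulrC.
Qed.

(** * The valuation ring of K *)

Section Integral.
Variables (K : fieldType) (S : subringClosed K).

(** [integralOver] takes a ring morphism; turning the subring into a ring type gives access to the
    closure properties of integral elements. *)
Definition subring_sort := {x : K | x \in S}.
HB.instance Definition _ := Choice.on subring_sort.
HB.instance Definition _ := SubType.on subring_sort.
HB.instance Definition _ := [SubChoice_isSubComNzRing of subring_sort by <:].

Lemma map_poly_subring (p : {poly K}) :
  (forall k, p`_k \in S) -> exists q : {poly subring_sort}, map_poly val q = p.
Proof.
move=> pS; exists (\poly_(i < size p) (Sub p`_i (pS i))).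
apply/polyP => i; rewrite coef_map coef_poly /=; by case: ltnP => // /(nth_default 0) ->.
Qed.

Variables (L : fieldType) (iota : {rmorphism K -> L}).

Lemma integral_closureE x :
  integral_closure iota [set y | y \in S]%classic x <->
  integralOver (iota \o (val : subring_sort -> K)) x.
Proof.
split=> [[p [pm pS rp]]|[p pm rp]].
  have [q qp] := map_poly_subring pS; exists q; last by rewrite map_poly_comp qp.
  by move: pm; rewrite -qp !monicE lead_coef_map_inj.
exists (map_poly val p); split; first exact: monic_map.
  by move=> k; rewrite coef_map /=; exact: valP.
by rewrite -map_poly_comp.
Qed.

End Integral.

Section Valuation.
Variables (K : fieldType) (v : K -> int).
Hypothesis hK : local_field v.

Local Notation O := (integers v).
Local Notation ge := (val_ge v).

Lemma val1 : v 1 = 0.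
Proof.
have := Defs.valM hK (oner_neq0 K) (oner_neq0 K); rewrite mulr1 => /eqP.
by rewrite -subr_eq subrr => /eqP.
Qed.

Lemma valV x : x != 0 -> v x^-1 = - v x.
Proof.
move=> x0; apply/eqP; rewrite -addr_eq0 addrC -(Defs.valM hK) ?invr_neq0 //.
by rewrite divff // val1.
Qed.

Lemma valN1 : v (-1) = 0.
Proof.
have N0 : (-1 : K) != 0 by rewrite oppr_eq0 oner_neq0.
by have := Defs.valM hK N0 N0; rewrite mulrNN mulr1 val1; lia.
Qed.

Lemma val_ge0 N : ge N 0. Proof. by left. Qed.

Lemma val_geW M N x : N <= M -> ge M x -> ge N x.
Proof. by move=> NM [->|h]; [left|right; exact: le_trans h]. Qed.

Lemma val_geM M N x y : ge M x -> ge N y -> ge (M + N) (x * y).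
Proof.
have [->|x0] := eqVneq x 0; first by rewrite mul0r; left.
have [->|y0] := eqVneq y 0; first by rewrite mulr0; left.
case=> [x00|hx]; first by rewrite x00 eqxx in x0.
case=> [y00|hy]; first by rewrite y00 eqxx in y0.
by right; rewrite (Defs.valM hK) // lerD.
Qed.

Lemma val_geN N x : ge N x -> ge N (- x).
Proof.
rewrite -mulN1r -[N in ge N (_ * _)]add0r; apply: val_geM.
by right; rewrite valN1.
Qed.

Lemma val_geD N x y : ge N x -> ge N y -> ge N (x + y).
Proof.
have [->|x0] := eqVneq x 0; first by rewrite add0r.
have [->|y0] := eqVneq y 0; first by rewrite addr0.
have [->|xy0] := eqVneq (x + y) 0; first by left.
case=> [x00|hx]; first by rewrite x00 eqxx in x0.
case=> [y00|hy]; first by rewrite y00 eqxx in y0.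
by right; apply: le_trans (valD hK x0 y0 xy0); rewrite le_min hx hy.
Qed.

Lemma val_geB N x y : ge N x -> ge N y -> ge N (x - y).
Proof. by move=> hx hy; apply: val_geD => //; exact: val_geN. Qed.

Lemma val_ge_sum N (I : Type) (r : seq I) (P : pred I) (F : I -> K) :
  (forall i, P i -> ge N (F i)) -> ge N (\sum_(i <- r | P i) F i).
Proof.
move=> h; apply: (big_ind (ge N)) => //; first exact: val_ge0.
by move=> x y; exact: val_geD.
Qed.

Lemma val_ge_all x : (forall N : nat, ge N%:Z x) -> x = 0.
Proof.
move=> h; apply: contrapT => x0; have := h `|v x|.+1 => -[//|].
by lia.
Qed.

Lemma integers1 : O 1. Proof. by right; rewrite val1. Qed.

Lemma integersM x y : O x -> O y -> O (x * y).
Proof. by move=> hx hy; rewrite /integers -[0]addr0; exact: val_geM. Qed.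

Lemma integersX x k : O x -> O (x ^+ k).
Proof.
move=> hx; elim: k => [|k IH]; first by rewrite expr0; exact: integers1.
by rewrite exprS; exact: integersM.
Qed.

Definition integers_pred : {pred K} := fun x => `[<O x>].

Lemma integers_predE x : (x \in integers_pred) = `[<O x>]. Proof. by []. Qed.

Lemma integers_subring : subring_closed integers_pred.
Proof.
split=> [|x y|x y]; rewrite !integers_predE; first exact/asboolP/integers1.
  by move=> /asboolP hx /asboolP hy; apply/asboolP; exact: val_geB.
by move=> /asboolP hx /asboolP hy; apply/asboolP; exact: integersM.
Qed.

Definition integers_mixin := GRing.isSubringClosed.Build K integers_pred integers_subring.
Definition integers_ring : subringClosed K := HB.pack integers_pred integers_mixin.

Lemma integers_ringE : O = [set y | y \in integers_ring]%classic.
Proof. by apply/seteqP; split=> x /= /asboolP. Qed.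

Lemma nonunits_integersP x : nonunits O x <-> ge 1 x.
Proof.
split=> [[_ [->|nx]]|[->|vx]]; first by left.
- have [->|xn0] := eqVneq x 0; first by left.
  right; rewrite leNgt; apply/negP => v1; apply: nx; right; rewrite valV //.
  by lia.
- by split; left.
- split; first by right; lia.
  have [->|xn0] := eqVneq x 0; first by left.
  right=> -[/eqP|]; first by rewrite invr_eq0 (negPf xn0).
  by rewrite valV //; lia.
Qed.

Lemma residue_classP x y : O x -> O y ->
  residue_class O x = residue_class O y <-> ge 1 (x - y).
Proof.
move=> Ox Oy; split=> [h|h].
  have : residue_class O x x.
    by split=> //; apply/nonunits_integersP; rewrite subrr; left.
  by rewrite h => -[_ /nonunits_integersP].
apply/seteqP; split=> z [Oz /nonunits_integersP hz]; split=> //;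
  apply/nonunits_integersP.
- by rewrite (_ : z - y = z - x + (x - y)); [exact: val_geD|ring].
- by rewrite (_ : z - x = z - y - (x - y)); [exact: val_geB|ring].
Qed.

(** Labels in ['I_q] stand for the residue classes: the pigeonhole and reindexing arguments below
    need a finite type but no ring structure on it. *)
Lemma residue_index q : (residue_field O #= `I_q)%card ->
  exists cl : K -> 'I_q, 
    (forall x y, O x -> O y -> cl x = cl y <-> ge 1 (x - y)) /\
    (forall i, exists2 x, O x & cl x = i).
Proof.
move=> /card_set_bijP[f [fI finj fsurj]].
have clP x : O x -> (f (residue_class O x) < q)%N.
  by move=> Ox; apply: fI; exists x.
have q0 : (0 < q)%N by exact: leq_ltn_trans (clP 1 integers1).
exists (fun x => odflt (Ordinal q0) (insub (f (residue_class O x)))).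
split=> [x y Ox Oy|i].
  rewrite !insubT ?clP // => h1 h2 /=; rewrite -residue_classP //; split=> [|e];
    last by apply: val_inj; rewrite /= e.
    move=> /(congr1 val) /= h; apply: finj => //; rewrite inE; [by exists x|by exists y].
have [_ [x Ox <-] fx] := fsurj i (ltn_ord i).
exists x => //; rewrite insubT ?clP // => h /=; exact: val_inj.
Qed.

(** Adding 1 permutes the residue classes. With representatives [r i], the terms [r i + 1 - r (s i)]
    lie in the maximal ideal and their sum is [q]. *)
Lemma card_residue_nonunit q : (residue_field O #= `I_q)%card -> ge 1 q%:R.
Proof.
move=> /residue_index[cl [clP clsurj]].
have /choice[r hr] : forall i : 'I_q, exists x, O x /\ cl x = i.
  by move=> i; have [x] := clsurj i; exists x.
pose s (i : 'I_q) := cl (r i + 1).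
have Or1 i : O (r i + 1) by apply: val_geD; [exact: (hr i).1|exact: integers1].
have sinj : injective s.
  move=> i j sij; have := (clP _ _ (Or1 i) (Or1 j)).1 sij.
  rewrite (_ : _ - _ = r i - r j); last by ring.
  move=> h.
  by rewrite -(hr i).2 -(hr j).2; apply/clP => //; [exact: (hr i).1|exact: (hr j).1].
have -> : q%:R = \sum_i (r i + 1 - r (s i)).
  rewrite sumrB big_split /= [X in _ - X](_ : _ = \sum_i r i).
    by rewrite addrAC subrr add0r sumr_const card_ord.
  by rewrite [RHS](reindex_inj sinj).
apply: val_ge_sum => i _; apply: (clP _ _ (Or1 i) (hr (s i)).1).1.
by rewrite (hr (s i)).2.
Qed.
End Valuation.

(** * The integral closure is a local ring *)

Section IntegralClosure.
Variables (K : fieldType) (v : K -> int).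
Hypothesis hK : local_field v.
Variables (L : fieldType) (iota : {rmorphism K -> L}).

Local Notation O := (integers v).
Local Notation ge := (val_ge v).
Local Notation OL := (integral_closure iota O).
Local Notation mL := (nonunits OL).

Lemma int_closureE x : OL x <->
  integralOver (iota \o (val : subring_sort (integers_ring hK) -> K)) x.
Proof. by rewrite (integers_ringE hK); exact: integral_closureE. Qed.

Lemma int_closureD x y : OL x -> OL y -> OL (x + y).
Proof. by move=> /int_closureE hx /int_closureE hy; apply/int_closureE/integral_add. Qed.

Lemma int_closureB x y : OL x -> OL y -> OL (x - y).
Proof. by move=> /int_closureE hx /int_closureE hy; apply/int_closureE/integral_sub. Qed.

Lemma int_closureM x y : OL x -> OL y -> OL (x * y).
Proof. by move=> /int_closureE hx /int_closureE hy; apply/int_closureE/integral_mul. Qed.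

Lemma int_closureN x : OL x -> OL (- x).
Proof. by move=> /int_closureE hx; apply/int_closureE/integral_opp. Qed.

Lemma int_closure_iota x : O x -> OL (iota x).
Proof.
move=> Ox; have xS : x \in integers_ring hK by exact/asboolP.
apply/int_closureE.
exact: (integral_id (iota \o (val : subring_sort (integers_ring hK) -> K)) (exist _ x xS)).
Qed.

Lemma int_closure0 : OL 0. Proof. exact/int_closureE/integral0. Qed.
Lemma int_closure1 : OL 1. Proof. exact/int_closureE/integral1. Qed.

Lemma int_closureX x k : OL x -> OL (x ^+ k).
Proof.
move=> hx; elim: k => [|k IH]; first by rewrite expr0; exact: int_closure1.
by rewrite exprS; exact: int_closureM.
Qed.

Lemma int_closure_sum (I : Type) (r : seq I) (P : pred I) (F : I -> L) :
  (forall i, P i -> OL (F i)) -> OL (\sum_(i <- r | P i) F i).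
Proof.
move=> h; apply: (big_ind OL) => //; first exact: int_closure0.
by move=> x y; exact: int_closureD.
Qed.

(** Valuation rings are integrally closed: if [v x < 0], dividing the monic equation of [x] by
    [x ^+ n] writes 1 as a sum of elements of the maximal ideal. *)
Lemma int_closure_baseP x : OL (iota x) <-> O x.
Proof.
split; last exact: int_closure_iota.
move=> [p [pm pO rp]]; apply: contrapT => nOx.
have x0 : x != 0 by apply/eqP => x0; apply: nOx; left.
have Oxi : ge 1 x^-1.
  right; rewrite (valV hK) //; have : ~ (0 <= v x) by move=> h; apply: nOx; right.
  by lia.
move: rp; rewrite /root horner_map fmorph_eq0 => /eqP px.
have p0 : (0 < size p)%N by rewrite size_poly_gt0 monic_neq0.
have := horner_coef p x; rewrite px -(prednK p0) big_ord_recr /=.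
rewrite -/(lead_coef p) (monicP pm) mul1r.
move: (size p).-1 => n /esym/eqP; rewrite addr_eq0 => /eqP hs.
suff : ge 1 (x ^+ n * x ^- n).
  by rewrite mulfV ?expf_neq0 // => -[/eqP|]; rewrite ?oner_eq0 // (val1 hK).
rewrite -[X in X * _]opprK -[X in - X * _]hs mulNr mulr_suml.
apply/(val_geN hK)/(val_ge_sum hK) => i _; rewrite -mulrA.
rewrite (_ : x ^+ i * _ = x^-1 * x^-1 ^+ (n - i.+1)); last first.
  rewrite -exprVn -exprS -subSn // subSS; apply: (mulfI (expf_neq0 i (invr_neq0 x0))).
  rewrite -exprD subnKC ?(ltnW (ltn_ord i)) // mulrA -exprMn mulVf // expr1n.
  by rewrite mul1r.
rewrite mulrCA -[1]addr0; apply: (val_geM hK) => //; apply: (integersM hK) => //.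
by apply: (integersX hK); exact: val_geW Oxi.
Qed.

(** Homogenising the equation [p] of [b] by [t] gives a monic polynomial killing [w = t b]. Its
    value [c] at 1 is congruent to 1, hence a unit of [O], and subtracting its value at [w] shows
    that [c] is [1 - w] times an integral element [T]. *)
Lemma int_closure_sub1_unit t b : ge 1 t -> OL b ->
  1 - iota t * b != 0 /\ OL (1 - iota t * b)^-1.
Proof.
move=> t1 Ob; have [p [pm pO rp]] := Ob; set w := iota t * b.
have Ow : OL w by apply: int_closureM => //; apply: int_closure_iota; exact: val_geW t1.
have p0 : (0 < size p)%N by rewrite size_poly_gt0 monic_neq0.
pose n := (size p).-1.
have Ot k : O (t ^+ k) by apply: (integersX hK); exact: val_geW t1.
pose c := \sum_(k < n.+1) p`_k * t ^+ (n - k).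
have c1 : ge 1 (c - 1).
  rewrite /c big_ord_recr /= subnn expr0 mulr1 -[p`_n]/(lead_coef p) (monicP pm) addrK.
  apply: (val_ge_sum hK) => i _; rewrite -[1]add0r; apply: (val_geM hK); first exact: pO.
  rewrite -(prednK (n := n - i)) ?subn_gt0 // exprS.
  by rewrite -[1]addr0; apply: (val_geM hK) => //; exact: Ot.
have nc1 : ~ ge 1 c.
  move=> h; have : ge 1 (c - (c - 1)) by exact: (val_geB hK).
  by rewrite subKr => -[/eqP|]; rewrite ?oner_eq0 // (val1 hK).
have c0 : c != 0 by apply/eqP => c0; apply: nc1; rewrite c0; left.
have Oc : O c^-1.
  by right; rewrite (valV hK) //; have : ~ 1 <= v c by [move=> h; apply: nc1; right]; lia.
pose T := \sum_(k < n.+1) iota (p`_k * t ^+ (n - k)) * \sum_(j < k) w ^+ j.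
have OT : OL T.
  apply: int_closure_sum => k _; apply: int_closureM.
    by apply: int_closure_iota; apply: (integersM hK).
  by apply: int_closure_sum => j _; exact: int_closureX.
have uT : iota c = (1 - w) * T.
  have z : \sum_(k < n.+1) iota (p`_k * t ^+ (n - k)) * w ^+ k = 0.
    transitivity (iota t ^+ n * (map_poly iota p).[b]); last by rewrite (eqP rp) mulr0.
    rewrite horner_coef size_map_poly -(prednK p0) mulr_sumr; apply: eq_bigr => k _.
    have kn : (k <= n)%N by rewrite -ltnS.
    have tn : iota t ^+ n = iota t ^+ (n - k) * iota t ^+ k by rewrite -exprD subnK.
    by rewrite coef_map /= /w exprMn rmorphM rmorphXn tn /=; ring.
  rewrite -[LHS]subr0 -z /c rmorph_sum -sumrB /T mulr_sumr; apply: eq_bigr => k _.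
  have := subrX1 w k => h.
  rewrite -[X in X - _]mulr1 -mulrBr -opprB h mulrCA -mulNr opprB.
  by rewrite mulrCA.
have cn0 : iota c != 0 by rewrite fmorph_eq0.
have u0 : 1 - w != 0 by apply: contraNneq cn0 => u0; rewrite uT u0 mul0r.
split=> //; rewrite (_ : _^-1 = T * iota c^-1).
  by apply: int_closureM => //; exact: int_closure_iota.
apply: (mulfI u0); rewrite mulfV // mulrA -uT fmorphV mulfV //.
Qed.

Lemma int_closure_eigenvalue n (B : 'M[K]_n) (w : 'rV[L]_n) b :
  (forall i j, O (B i j)) -> w *m map_mx iota B = b *: w -> w != 0 -> OL b.
Proof.
move=> OB wB w0; exists (char_poly B); split; first exact: char_poly_monic.
  have h : char_poly B \is a polyOver (integers_ring hK).
    have entry i j : char_poly_mx B i j \is a polyOver (integers_ring hK).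
      rewrite !mxE rpredB ?rpredMn ?polyOverX // polyOverC.
      exact/asboolP.
    rewrite /char_poly /determinant rpred_sum // => s _.
    by rewrite rpredM ?rpredX ?rpredN ?rpred1 // rpred_prod.
  by move=> k; have /polyOverP/(_ k)/asboolP := h.
by rewrite map_char_poly -eigenvalue_root_char; apply/eigenvalueP; exists w.
Qed.

Section Idempotent.
Variables (n : nat) (C : 'M[K]_n.+1) (N : nat).

Definition mx_ge M (A : 'M[K]_n.+1) := forall i j, ge M (A i j).

Lemma mx_geM a b A B : mx_ge a A -> mx_ge b B -> mx_ge (a + b) (A * B).
Proof.
move=> hA hB i j; rewrite mxE; apply: (val_ge_sum hK) => k _.
exact: (val_geM hK).
Qed.

Lemma mx_geD a A B : mx_ge a A -> mx_ge a B -> mx_ge a (A + B).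
Proof. by move=> hA hB i j; rewrite mxE; exact: (val_geD hK). Qed.

Lemma mx_geN a A : mx_ge a A -> mx_ge a (- A).
Proof. by move=> hA i j; rewrite mxE; exact: (val_geN hK). Qed.

Lemma mx_geB a A B : mx_ge a A -> mx_ge a B -> mx_ge a (A - B).
Proof. by move=> hA hB; apply: mx_geD => //; exact: mx_geN. Qed.

Lemma mx_geMn a A k : mx_ge a A -> mx_ge a (A *+ k).
Proof.
move=> hA; elim: k => [|k IH]; first by move=> i j; rewrite mxE; left.
by rewrite mulrS; exact: mx_geD.
Qed.

Lemma mx_geW a b A : a <= b -> mx_ge b A -> mx_ge a A.
Proof. by move=> ab hA i j; exact: val_geW (hA i j). Qed.

Lemma mx_ge1 : mx_ge 0 1.
Proof.
move=> i j; rewrite mxE; case: (i == j); [exact: (integers1 hK)|by left].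
Qed.

Lemma mx_ge_all A : (forall k : nat, mx_ge k%:Z A) -> A = 0.
Proof.
by move=> h; apply/matrixP => i j; rewrite mxE; apply: (@val_ge_all _ v) => k; exact: h.
Qed.

Hypothesis C0 : mx_ge 0 C.
Hypothesis CN : mx_ge 1 (C ^+ N * C ^+ N - C ^+ N).

(* Newton's iteration for the equation [e ^ 2 = e]. *)
Fixpoint idem_poly r : {poly K} :=
  if r is r'.+1 then idem_poly r' ^+ 2 *+ 3 - idem_poly r' ^+ 3 *+ 2 else 'X^N.

Let e r := horner_mx C (idem_poly r).

Let e_S r : e r.+1 = e r ^+ 2 *+ 3 - e r ^+ 3 *+ 2.
Proof. by rewrite /e /= rmorphB !rmorphMn /= !rmorphXn. Qed.

Let e0 : e 0 = C ^+ N.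
Proof. by rewrite /e /= rmorphXn /= horner_mx_X. Qed.

Let e_int r : mx_ge 0 (e r).
Proof.
elim: r => [|r IH].
  rewrite e0; elim: N => [|k IH]; first by rewrite expr0; exact: mx_ge1.
  by rewrite exprS -[0]addr0; exact: mx_geM.
rewrite e_S; apply: mx_geB; apply: mx_geMn; rewrite ?[_ ^+ 3]exprS expr2.
  by rewrite -[0]addr0; exact: mx_geM.
by rewrite -[0]addr0; apply: mx_geM => //; rewrite -[0]addr0; exact: mx_geM.
Qed.

(** The error of each iterate is a multiple of the square of the preceding error. *)
Let e_idem r : mx_ge r.+1%:Z (e r * e r - e r).
Proof.
elim: r => [|r IH]; first by rewrite e0.
have -> : e r.+1 * e r.+1 - e r.+1 =
    (e r * e r - e r) * (e r * e r - e r) * ((e r * e r - e r) *+ 4 - 1 *+ 3).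
  (* All iterates are polynomials in [C], so the identity is checked in the commutative ring
     [{poly K}]. *)
  rewrite -(rmorph1 (horner_mx C)) /e -!(rmorphM, rmorphB, rmorphMn) /=.
  congr horner_mx; set p := idem_poly r; ring.
rewrite -[X in mx_ge X]addr0; apply: mx_geM.
  by apply: (@mx_geW _ (r.+1%:Z + r.+1%:Z)); [lia|exact: mx_geM].
apply: mx_geB; apply: mx_geMn; last exact: mx_ge1.
by apply: mx_geW IH.
Qed.

Let e_step r : mx_ge r.+1%:Z (e r.+1 - e r).
Proof.
have -> : e r.+1 - e r = (e r * e r - e r) * (1 - e r *+ 2).
  rewrite -(rmorph1 (horner_mx C)) /e -!(rmorphM, rmorphB, rmorphMn) /=.
  congr horner_mx; set p := idem_poly r; ring.
rewrite -[X in mx_ge X]addr0; apply: mx_geM => //.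
by apply: mx_geB; [exact: mx_ge1|exact: mx_geMn].
Qed.

Let e_cauchy r s : mx_ge r.+1%:Z (e (r + s) - e r).
Proof.
elim: s => [|s IH]; first by rewrite addn0 subrr => i j; rewrite mxE; left.
rewrite addnS -(subrKA (e (r + s))) /=; apply: mx_geD => //.
by apply: mx_geW (e_step _); lia.
Qed.

(** Completeness of [K] gives the entrywise limit of the iterates. The two equations hold in the
    limit because their defects have arbitrarily large valuation. *)
Lemma lift_idempotent : exists E : 'M[K]_n.+1,
  [/\ E * E = E, E * C = C * E, mx_ge 0 E & mx_ge 1 (E - C ^+ N)].
Proof.
have /choice[E' hE'] : forall ij, exists l, val_cvg v (fun r => e r ij.1 ij.2) l.
  move=> ij; apply: (val_complete hK) => M; exists `|M|%N => a b Ma Mb.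
  wlog ab : a b Ma Mb / (b <= a)%N.
    move=> h; have [/h|/ltnW/h] := leqP b a; first exact.
    by move=> /(_ Mb Ma) h'; rewrite -opprB; exact: (val_geN hK).
  apply: (@val_geW _ _ b.+1%:Z); first by lia.
  by rewrite -(subnKC ab); have := e_cauchy b (a - b)%N ij.1 ij.2; rewrite !mxE.
pose E : 'M[K]_n.+1 := \matrix_(i, j) E' (i, j).
have eE r : mx_ge r.+1%:Z (E - e r).
  move=> i j; have [s hs] := hE' (i, j) r.+1%:Z.
  rewrite !mxE (_ : _ - _ = (e (r + s) i j - e r i j) - (e (r + s) i j - E' (i, j))); last by ring.
  apply: (val_geB hK); last by apply: hs; rewrite leq_addl.
  by have := e_cauchy r s i j; rewrite !mxE.
have E0 : mx_ge 0 E.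
  rewrite -(subrK (e 0) E); apply: mx_geD => //; exact: mx_geW (eE 0).
exists E; split=> //; last by rewrite -e0; exact: eE.
  apply/subr0_eq/mx_ge_all => k; apply: (@mx_geW _ k.+1%:Z); first by lia.
  rewrite (_ : E * E - E = (E - e k) * E + e k * (E - e k) + (e k * e k - e k) - (E - e k)).
    apply: mx_geB => //; apply: mx_geD => //; apply: mx_geD.
      by rewrite -[X in mx_ge X]addr0; exact: mx_geM.
    by rewrite -[X in mx_ge X]add0r; exact: mx_geM.
  by rewrite mulrBl mulrBr opprB !addrA !subrK.
apply/subr0_eq/mx_ge_all => k; apply: (@mx_geW _ k.+1%:Z); first by lia.
have ec : e k * C = C * e k.
  by apply: comm_horner_mx.
rewrite (_ : E * C - C * E = (E - e k) * C - C * (E - e k)).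
  apply: mx_geB; first by rewrite -[X in mx_ge X]addr0; exact: mx_geM.
  by rewrite -[X in mx_ge X]add0r; exact: mx_geM.
by rewrite mulrBl mulrBr ec opprB addrA subrK.
Qed.

End Idempotent.

(** Modulo the maximal ideal the powers of [C] take finitely many values, so they are eventually
    periodic. *)
Lemma exists_pow_idem n (C : 'M[K]_n.+1) : mx_ge 0 C ->
  exists2 N, (0 < N)%N & mx_ge 1 (C ^+ N * C ^+ N - C ^+ N).
Proof.
move=> C0; have [q] := (finite_setP _).1 (residue_finite hK).
move=> /(residue_index hK)[cl [clP _]].
have CX k : mx_ge 0 (C ^+ k).
  elim: k => [|k IH]; first by rewrite expr0; exact: mx_ge1.
  by rewrite exprS -[0]addr0; exact: mx_geM.
pose T : finType := 'M['I_q]_n.+1.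
pose f (i : 'I_#|T|.+1) : T := map_mx cl (C ^+ i.+1).
have /injectivePn[i [j ij fij]] : ~~ injectiveb f.
  by apply/injectiveP => /leq_card; rewrite card_ord ltnn.
wlog lt_ij : i j ij fij / (i < j)%N.
  move=> h; have [|lt|] := ltngtP i j; first exact: h fij.
    by apply: (h j i) => //; rewrite eq_sym.
  by move=> /val_inj/eqP; rewrite (negPf ij).
have step : mx_ge 1 (C ^+ (j - i + i.+1) - C ^+ i.+1).
  rewrite addnS subnK ?(ltnW lt_ij) // => a b.
  have h := congr1 (fun M : T => M a b) fij; rewrite !mxE in h *.
  by apply: (clP _ _ _ _).1 => //; exact: CX.
have step1 M : (i < M)%N -> mx_ge 1 (C ^+ (j - i + M) - C ^+ M).
  move=> iM; rewrite -(subnK iM) addnCA !(exprD _ (M - i.+1)) -mulrBr.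
  by rewrite -[1]add0r; exact: mx_geM.
have steps k M : (i < M)%N -> mx_ge 1 (C ^+ (k * (j - i) + M) - C ^+ M).
  move=> iM; elim: k => [|k IH].
    by rewrite mul0n add0n subrr => x y; rewrite mxE; left.
  rewrite mulSn -addnA -(subrKA (C ^+ (k * (j - i) + M))) /=; apply: mx_geD => //.
  by apply: step1; rewrite (leq_trans iM) // leq_addl.
have ij0 : (0 < j - i)%N by rewrite subn_gt0.
(* This is a multiple of the period [j - i] lying beyond the preperiod, so that doubling the
   exponent changes nothing. *)
exists (i.+1 * (j - i))%N; first by rewrite muln_gt0.
by rewrite -exprD; apply: steps; rewrite leq_pmulr.
Qed.

(* As the residue field is finite, some power [C ^+ N] of a companion matrix is
   idempotent modulo the maximal ideal, hence congruent to an idempotent [E]; an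
   eigenvector of [C] for [x] can be chosen to be an eigenvector of [E]. *)
Lemma integral_pow_idem p x : p \is monic -> (forall k, O p`_k) ->
    root (map_poly iota p) x -> forall t, t != 0 -> v t = 1 ->
  exists2 N, (0 < N)%N & exists2 e, e = 0 \/ e = 1 &
    exists2 b, OL b & e - x ^+ N = iota t * b.
Proof.
move=> pm pO rp t t0 vt.
have [n [C [CO Cp]]] : exists n (C : 'M[K]_n.+1),
    (forall i j, O (C i j)) /\ char_poly C = p.
  have CO i j : O (companionmx p i j).
    rewrite mxE; case: ifP => _; first exact/(val_geN hK)/pO.
    by case: (_ == _); [exact: (integers1 hK)|left].
  have := companionmxK pm; have : ((size p).-1 > 0)%N.
    have : (1 < size (map_poly iota p))%N.
      by apply: (root_size_gt1 _ rp); rewrite map_poly_eq0 monic_neq0.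
    by rewrite size_map_poly; case: (size p) => // -[].
  by move: (companionmx p) CO; case: (size p).-1 => // n C CO _ Cp; exists n, C.
have /eigenvalueP[w wC w0] : eigenvalue (map_mx iota C) x.
  by rewrite eigenvalue_root_char -map_char_poly Cp.
have [N N0 CN] := exists_pow_idem CO.
have [E [EE EC _ EN]] := lift_idempotent CO CN.
have wCk k : w *m map_mx iota (C ^+ k) = x ^+ k *: w.
  elim: k => [|k IH]; first by rewrite !expr0 map_mx1 mulmx1 scale1r.
  by rewrite exprSr map_mxM mulmxA IH -scalemxAl wC scalerA -exprSr.
(* As [E] commutes with [C], either [w E = 0] and [w] serves with [e = 0], or [w E] is a common
   eigenvector with [e = 1]. *)
have [e e01 [u u0 [uE uC]]] : exists2 e : L, e = 0 \/ e = 1 &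
    exists2 u : 'rV[L]_n.+1, u != 0 &
      u *m map_mx iota E = e *: u /\ u *m map_mx iota (C ^+ N) = x ^+ N *: u.
  have [wE|wE] := eqVneq (w *m map_mx iota E) 0.
    by exists 0; [left|exists w => //; rewrite wE scale0r wCk].
  exists 1; [by right|exists (w *m map_mx iota E) => //].
  rewrite -mulmxA -map_mxM [E *m E]EE scale1r; split=> //.
  have EX : GRing.comm E (C ^+ N) by apply: commrX.
  by rewrite -mulmxA -map_mxM [E *m _]EX map_mxM mulmxA wCk scalemxAl.
exists N => //; exists e => //; exists (iota t^-1 * (e - x ^+ N)); last first.
  by rewrite mulrA -rmorphM mulfV // rmorph1 mul1r.
(* The matrix [(E - C ^+ N) / t] still has entries in [O], because [v t = 1], and its eigenvalue at
   [u] is [(e - x ^+ N) / t]. *)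
apply: (@int_closure_eigenvalue _ (t^-1 *: (E - C ^+ N)) u) => //.
  move=> i j; rewrite mxE; apply: (@val_geW _ _ (-1 + 1)) => //; apply: (val_geM hK);
    last exact: EN.
  by right; rewrite (valV hK) // vt.
by rewrite map_mxZ -scalemxAr map_mxB mulmxBr uE uC -scalerBl scalerA.
Qed.

(** This is what makes the integral closure local. By [integral_pow_idem] a power of [x] is
    congruent to 0 or to 1 modulo [t]; accordingly [1 - x] or [x] divides a unit provided by
    [int_closure_sub1_unit]. *)
Lemma int_closure_unit_or x : OL x ->
  (x != 0 /\ OL x^-1) \/ (1 - x != 0 /\ OL (1 - x)^-1).
Proof.
move=> Ox; have [p [pm pO rp]] := Ox; have [t t0 vt] := val_uniformizer hK.
have t1 : ge 1 t by right; rewrite vt.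
have [[//|N] _ [e e01 [b Ob eb]]] := integral_pow_idem pm pO rp t0 vt.
case: e01 eb => ->.
  rewrite sub0r => /eqP; rewrite eqr_oppLR -mulrN => /eqP xN; right.
  have [u0 Ou] := int_closure_sub1_unit t1 (int_closureN Ob).
  have h : (1 - x) * (\sum_(i < N.+1) x ^+ i) = 1 - iota t * - b.
    by rewrite -xN -opprB mulNr -subrX1 opprB.
  have x1 : 1 - x != 0 by apply: contraNneq u0 => x1; rewrite -h x1 mul0r.
  split=> //; rewrite (_ : _^-1 = (\sum_(i < N.+1) x ^+ i) * (1 - iota t * - b)^-1).
    by apply: int_closureM => //; apply: int_closure_sum => i _; exact: int_closureX.
  by apply: (mulfI x1); rewrite mulfV // mulrA h mulfV.
move=> xN; left; have [u0 Ou] := int_closure_sub1_unit t1 Ob.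
have h : x * x ^+ N = 1 - iota t * b by rewrite -xN -exprS opprB addrC subrK.
have x0 : x != 0 by apply: contraNneq u0 => x0; rewrite -h x0 mul0r.
split=> //; rewrite (_ : _^-1 = x ^+ N * (1 - iota t * b)^-1).
  by apply: int_closureM => //; exact: int_closureX.
by apply: (mulfI x0); rewrite mulfV // mulrA h mulfV.
Qed.

Lemma nonunitP x : mL x <-> OL x /\ ~ (x != 0 /\ OL x^-1).
Proof.
split=> -[Ox h]; split=> //; first by case=> x0 Oxi; case: h => // /eqP; rewrite (negPf x0).
by have [->|x0] := eqVneq x 0; [left|right=> Oxi; apply: h].
Qed.

Lemma nonunit0 : mL 0. Proof. by split; [exact: int_closure0|left]. Qed.

Lemma nonunit1 : ~ mL 1.
Proof. by case=> _ [/eqP|]; rewrite ?oner_eq0 // invr1; apply; exact: int_closure1. Qed.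

Lemma nonunitM a x : OL a -> mL x -> mL (a * x).
Proof.
move=> Oa /nonunitP[Ox hx]; apply/nonunitP; split; first exact: int_closureM.
rewrite mulf_eq0 negb_or invfM => -[/andP[a0 x0] Oi]; apply: hx; split=> //.
by rewrite -[x^-1](mulVKf a0); exact: int_closureM.
Qed.

Lemma nonunitN x : mL x -> mL (- x).
Proof. by rewrite -mulN1r; apply: nonunitM; apply: int_closureN; exact: int_closure1. Qed.

(** If [x + y] were a unit, [x / (x + y)] and [y / (x + y)] would be nonunits with sum 1, against
    [int_closure_unit_or]. *)
Lemma nonunitD x y : mL x -> mL y -> mL (x + y).
Proof.
move=> mx my; apply/nonunitP; split; first by apply: int_closureD; [case: mx|case: my].
move=> [xy0 Oi]; have mxu := nonunitM Oi mx; have myu := nonunitM Oi my.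
have e : (x + y)^-1 * y = 1 - (x + y)^-1 * x.
  by apply/eqP; rewrite eq_sym subr_eq -mulrDr (addrC y) mulVf.
case: (int_closure_unit_or mxu.1) => h.
  by have /nonunitP[_ []] := mxu.
by have /nonunitP[_ []] := myu; rewrite e.
Qed.

Lemma nonunitB x y : mL x -> mL y -> mL (x - y).
Proof. by move=> hx hy; apply: nonunitD => //; exact: nonunitN. Qed.

Lemma nonunit_prime x y : OL x -> OL y -> mL (x * y) -> mL x \/ mL y.
Proof.
move=> Ox Oy /nonunitP[_ hxy]; apply: contrapT => /not_orP[nx ny]; apply: hxy.
have {nx}[x0 Oxi] : x != 0 /\ OL x^-1.
  by apply: contrapT => h; apply: nx; apply/nonunitP.
have {ny}[y0 Oyi] : y != 0 /\ OL y^-1.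
  by apply: contrapT => h; apply: ny; apply/nonunitP.
by rewrite mulf_neq0 // invfM; split=> //; exact: int_closureM.
Qed.

Lemma nonunit_baseP x : mL (iota x) <-> nonunits O x.
Proof.
rewrite /nonunits /= -fmorphV !int_closure_baseP.
split=> -[Ox h]; split=> //; case: h => h; [left|right|left|right] => //.
  by apply/eqP; rewrite -(fmorph_eq0 iota) h.
by rewrite h rmorph0.
Qed.

End IntegralClosure.

(** * Galois action on the residue field *)

Section GaloisAction.
Variables (K : fieldType) (v : K -> int).
Hypothesis hK : local_field v.
Variables (L : fieldType) (iota : {rmorphism K -> L}).

Local Notation O := (integers v).
Local Notation OL := (integral_closure iota O).
Local Notation mL := (nonunits OL).
Local Notation G := (galAut iota).

Lemma galM (g h : G) x : (g * h)%g x = g (h x). Proof. by []. Qed.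
Lemma galK (g : G) x : (g^-1)%g (g x) = x. Proof. by rewrite -galM mulVg. Qed.
Lemma galVK (g : G) x : g ((g^-1)%g x) = x. Proof. by rewrite -galM mulgV. Qed.
Lemma gal_iota (g : G) x : g (iota x) = iota x. Proof. by have [_ _ _ ->] := galP g. Qed.

Lemma map_poly_gal_iota (g : G) p : map_poly g (map_poly iota p) = map_poly iota p.
Proof. by apply/polyP => i; rewrite !coef_map /= gal_iota. Qed.

Lemma horner_gal (g : G) p x : g (map_poly iota p).[x] = (map_poly iota p).[g x].
Proof. by rewrite -horner_map map_poly_gal_iota. Qed.

Lemma root_gal (g : G) p x : root (map_poly iota p) x -> root (map_poly iota p) (g x).
Proof. by rewrite /root -horner_gal => /eqP ->; rewrite rmorph0. Qed.

Lemma int_closure_gal (g : G) x : OL x -> OL (g x).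
Proof. by move=> [p [pm pO rp]]; exists p; split=> //; exact: root_gal. Qed.

Lemma nonunit_gal (g : G) x : mL x -> mL (g x).
Proof.
move=> /nonunitP[Ox hx]; apply/nonunitP; split; first exact: int_closure_gal.
rewrite fmorph_eq0 -fmorphV => -[x0 /(int_closure_gal (g^-1)%g)].
by rewrite galK => Oi; apply: hx.
Qed.

Lemma nonunitBX x y k : OL x -> OL y -> mL (x - y) -> mL (x ^+ k - y ^+ k).
Proof.
move=> Ox Oy xy; rewrite subrXX_comm; last exact: mulrC.
rewrite mulrC; apply: (nonunitM hK) => //; apply: (int_closure_sum hK) => i _.
by apply: (int_closureM hK); exact: (int_closureX hK).
Qed.

Lemma nonunit_trans x y z : mL (x - y) -> mL (y - z) -> mL (x - z).
Proof. by move=> xy yz; rewrite -(subrKA y); exact: (nonunitD hK). Qed.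

Lemma nonunit_sym x y : mL (x - y) -> mL (y - x).
Proof. by move=> xy; rewrite -opprB; exact: (nonunitN hK). Qed.

Local Notation acts := (@acts_as_power _ v _ iota).

Lemma acts1 : acts 1 1%g.
Proof. by move=> x Ox; rewrite expr1 subrr; exact: nonunit0. Qed.

Lemma actsM a b g h : acts a g -> acts b h -> acts (a * b) (g * h)%g.
Proof.
move=> ag bh x Ox; rewrite galM.
apply: (@nonunit_trans _ (g (x ^+ b))).
  by rewrite -rmorphB; apply: nonunit_gal; exact: bh.
rewrite rmorphXn exprM; apply: nonunitBX; last exact: ag.
  exact: int_closure_gal.
exact: (int_closureX hK).
Qed.

Lemma actsX a g k : acts a g -> acts (a ^ k) (g ^+ k)%g.
Proof.
move=> ag; elim: k => [|k IH]; first exact: acts1.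
by rewrite expnS expgS; exact: actsM.
Qed.

(** Exponents are natural numbers, so inverses of Frobenius powers are reached by dividing
    exponents, here and in [acts_divl]. For [y = h x], both [g (h^-1 y) = g x] and [y ^+ a] are
    congruent to [x ^+ (b * a)]. *)
Lemma acts_divr a b g h : acts (b * a) g -> acts b h -> acts a (g * h^-1)%g.
Proof.
move=> abg bh y Oy; pose x := (h^-1)%g y; have Ox : OL x by exact: int_closure_gal.
have yx : mL (y - x ^+ b) by have := bh x Ox; rewrite galVK.
rewrite galM -/x; apply: (nonunit_trans (abg x Ox)); rewrite exprM.
by apply: nonunitBX => //; [exact: (int_closureX hK)|exact: nonunit_sym].
Qed.

Lemma acts_divl a b g h : acts (a * b) g -> acts b h -> acts a (h^-1 * g)%g.
Proof.
move=> abg bh x Ox; rewrite galM -[_ - _](galK h); apply: nonunit_gal.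
rewrite rmorphB /= galVK rmorphXn /=; apply: (nonunit_trans (abg x Ox)).
apply: nonunit_sym; have := bh (x ^+ a) (int_closureX hK a Ox).
by rewrite rmorphXn -!exprM.
Qed.

Lemma actsV1 g : acts 1 g -> acts 1 (g^-1)%g.
Proof. by move=> g1; rewrite -[(g^-1)%g]mul1g; apply: (acts_divr _ g1); exact: acts1. Qed.

Lemma preimage_int_closure : (iota @^-1` OL = O)%classic.
Proof. by apply/seteqP; split=> x; rewrite /= (int_closure_baseP hK). Qed.

Lemma residue_card_gt1 q : residue_card v iota iota q -> (1 < q)%N /\ mL q%:R.
Proof.
rewrite /residue_card preimage_int_closure => qK.
have mq : mL q%:R.
  rewrite -(rmorph_nat iota); apply/(nonunit_baseP hK)/(nonunits_integersP hK).
  exact: card_residue_nonunit qK.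
split=> //; have [cl _] := residue_index hK qK.
case: q {qK} cl mq => [|[|//]] cl; first by case: (cl 0).
by move=> /(nonunit1 hK).
Qed.

Lemma residue_card_uniq (F : fieldType) (j : {rmorphism F -> L}) q q' :
  residue_card v iota j q -> residue_card v iota j q' -> q = q'.
Proof.
by move=> h h'; apply/card_eq_II; rewrite -(card_eql h).
Qed.

Lemma unity_root_int n x : (0 < n)%N -> x ^+ n = 1 -> OL x.
Proof.
move=> n0 xn; exists ('X^n - 1); split.
- by rewrite monicXnsubC.
- move=> k; rewrite coefB coefXn coef1; apply: (val_geB hK).
    by case: (_ == _); [exact: (integers1 hK)|left].
  by case: (_ == _); [exact: (integers1 hK)|left].
- by rewrite rmorphB /= map_polyXn rmorph1 /root !hornerE xn subrr.
Qed.

(** If [w = a / b] is not 1, the sum of the [w ^+ i] over [i < n] vanishes, whereas [w] congruent to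
    1 makes it congruent to [n]. *)
Lemma unity_root_cong n a b : (0 < n)%N -> ~ mL n%:R -> a ^+ n = 1 -> b ^+ n = 1 ->
  mL (a - b) -> a = b.
Proof.
move=> n0 mn an bn ab; have Oa := unity_root_int n0 an; have Ob := unity_root_int n0 bn.
have b0 : b != 0 by apply/eqP => b0; move: bn; rewrite b0 expr0n gtn_eqF // => /esym/eqP;
    rewrite oner_eq0.
have Ob' : OL b^-1 by apply: (@unity_root_int n) => //; rewrite exprVn bn invr1.
pose w := a / b; have wn : w ^+ n = 1 by rewrite /w expr_div_n an bn divr1.
have w1 : mL (w - 1).
  by rewrite (_ : w - 1 = b^-1 * (a - b)); [exact: (nonunitM hK)|rewrite /w; field].
have : w = 1; last by move=> /(congr1 ( *%R^~ b)); rewrite /w divfK // mul1r.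
apply: contrapT => /eqP wn1; apply: mn.
have s0 : \sum_(i < n) w ^+ i = 0.
  by apply/eqP; have := subrX1 w n; rewrite wn subrr => /esym/eqP;
    rewrite mulf_eq0 subr_eq0 (negPf wn1).
rewrite -[n%:R]subr0 -s0 -[X in X%:R]card_ord -sumr_const -sumrB.
apply: (big_ind mL) => [|x y|i _]; [exact: nonunit0|exact: (nonunitD hK)|].
rewrite -(expr1n _ i); apply: nonunitBX; [exact: int_closure1|exact: (unity_root_int n0)|].
exact: nonunit_sym.
Qed.

End GaloisAction.

(** * Primitive elements and automorphisms of the separable closure *)

Section SeparableClosure.
Variables (K L : fieldType) (iota : {rmorphism K -> L}).
Hypothesis hL : separable_closure iota.

Lemma separable_split (p : {poly L}) : separable_poly p ->
  exists rs, p %= \prod_(x <- rs) ('X - x%:P).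
Proof.
elim: {p}(size p) {-2}p (leqnn (size p)) => [|n IH] p.
  by rewrite leqn0 size_poly_eq0 => /eqP -> /separable_poly_neq0/eqP.
move=> pn sp; have [p1|p1] := leqP (size p) 1.
  exists [::]; rewrite big_nil -size_poly_eq1 eqn_leq p1 size_poly_gt0.
  exact: separable_poly_neq0.
have [x /factor_theorem[p' pE]] := sepcl_closed hL sp p1.
have p'0 : p' != 0.
  by have := separable_poly_neq0 sp; rewrite pE mulf_eq0 negb_or => /andP[].
have [||rs prs] := IH p'.
- by move: pn; rewrite pE size_mul ?polyXsubC_eq0 // size_XsubC addn2.
- by apply: dvdp_separable sp; rewrite pE dvdp_mulr.
exists (x :: rs); rewrite big_cons pE mulrC.
exact: eqp_mull.
Qed.

Lemma exists_primitive_root n : (0 < n)%N -> n%:R != 0 :> L ->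
  exists z : L, n.-primitive_root z.
Proof.
move=> n0 nn0; have [rs Xrs] := separable_split (separable_Xn_sub_1 nn0).
have urs : uniq rs.
  by rewrite -separable_prod_XsubC -(eqp_separable Xrs) separable_Xn_sub_1.
have := eqp_size Xrs; rewrite size_XnsubC // size_prod_XsubC => -[srs].
have /hasP[z _ zn] : has n.-primitive_root rs.
  apply: has_prim_root => //; last by rewrite -srs.
  apply/allP => x xrs; rewrite unity_rootE -subr_eq0.
  have : root ('X^n - 1) x by rewrite (eqp_root Xrs) root_prod_XsubC.
  by rewrite /root !hornerE.
by exists z.
Qed.

Definition in_adjoin (z w : L) := exists r, (map_poly iota r).[z] = w.

Lemma in_adjoin_trans x y z : in_adjoin z y -> in_adjoin y x -> in_adjoin z x.
Proof.
move=> [r <-] [s <-]; exists (s \Po r).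
by rewrite map_comp_poly horner_comp.
Qed.

Hypothesis infK : forall r : {poly L}, r != 0 -> exists t, ~~ root r (iota t).

(* [z] is obtained from [s] by K-linear combinations, so it is fixed by every
   automorphism fixing [s]. *)
Lemma exists_primitive_element (s : seq L) : exists2 z : L,
  forall g : galAut iota, {in s, g =1 id} -> g z = z &
  forall x, x \in s -> in_adjoin z x.
Proof.
elim: s => [|x s [y gy sy]]; first by exists 0 => // g _; rewrite rmorph0.
have [p sp px] := sepcl_separable hL x; have [q sq qy] := sepcl_separable hL y.
have [r r0 PET] := large_field_PET (separable_poly_neq0 sp) px qy sq.
have [t /PET[zx zy]] := infK r0.
exists (iota t * y - x).
  move=> g gs; rewrite rmorphB rmorphM /= gal_iota gy ?gs ?mem_head //.
  by move=> w ws; apply: gs; rewrite in_cons ws orbT.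
move=> w; rewrite in_cons => /predU1P[->//|ws].
exact: in_adjoin_trans zy (sy _ ws).
Qed.

Lemma gal_fixed_adjoin (g h : galAut iota) z w : in_adjoin z w -> g z = h z -> g w = h w.
Proof. by move=> [r <-] gz; rewrite !horner_gal gz. Qed.

Lemma gal_periodic (g : galAut iota) x : exists2 e, (0 < e)%N & (g ^+ e)%g x = x.
Proof.
have [p sp px] := sepcl_separable hL x; pose p' := map_poly iota p.
have p'0 : p' != 0 by rewrite map_poly_eq0 separable_poly_neq0.
pose rs := mkseq (fun i => (g ^+ i)%g x) (size p').
have rrs : all (root p') rs.
  by apply/allP => _ /mapP[i _ ->]; exact: root_gal.
have : ~~ uniq rs.
  by apply/negP => urs; have := max_poly_roots p'0 rrs urs; rewrite size_mkseq ltnn.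
move=> /(uniqPn 0)[i [j [ij]]]; rewrite size_mkseq => jp.
rewrite !nth_mkseq // ?(ltn_trans ij) // => gij.
exists (j - i)%N; first by rewrite subn_gt0.
apply: (fmorph_inj (g ^+ i)%g); rewrite /= -galM -expgD subnKC ?(ltnW ij) //.
Qed.

Lemma gal_periodic_seq (g : galAut iota) (s : seq L) :
  exists2 e, (0 < e)%N & forall x, x \in s -> (g ^+ e)%g x = x.
Proof.
have fixM e k x : (g ^+ e)%g x = x -> (g ^+ (e * k))%g x = x.
  move=> ge; elim: k => [|k IH]; first by rewrite muln0.
  by rewrite mulnS expgD galM IH.
elim: s => [|x s [e e0 es]]; first by exists 1%N.
have [e' e'0 ex] := gal_periodic g x.
exists (e * e')%N => [|w]; first by rewrite muln_gt0 e0.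
rewrite in_cons => /predU1P[->|ws]; first by rewrite mulnC; exact: fixM.
exact: fixM (es _ ws).
Qed.

(** This replaces the Galois correspondence for the group generated by [g]. Since [theta] generates
    the coefficients of [Q], an [h] fixing [theta] sends [eta] to some root [g ^+ a] of [eta] in its
    orbit; and [eta] generates [s]. *)
Lemma cyclic_fixed_field (g : galAut iota) (s t : seq L) :
  (forall x, x \in t -> g x = x) ->
  exists theta, [/\ g theta = theta, (forall x, x \in t -> in_adjoin theta x) &
    forall h : galAut iota, h theta = theta ->
      exists a, {in s, h =1 (g ^+ a)%g}].
Proof.
move=> gt; have [eta _ seta] := exists_primitive_element s.
have [e e0 geta] := gal_periodic g eta.
(* An automorphism fixing [Q] permutes the orbit of [eta] under [g]. *)
pose Q := \prod_(a < e) ('X - ((g ^+ a)%g eta)%:P).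
have gQ : map_poly g Q = Q.
  have XsubE x : map_poly g ('X - x%:P) = 'X - (g x)%:P.
    by rewrite rmorphB /= map_polyX map_polyC.
  rewrite /Q rmorph_prod /=; under eq_bigr do rewrite XsubE -galM -expgS.
  case: (e) e0 geta => // k _ gk.
  by rewrite big_ord_recr [RHS]big_ord_recl /= gk mulrC.
have [theta th tht] := exists_primitive_element (t ++ Q).
exists theta; split=> [|x xt|h htheta].
- apply: th => x; rewrite mem_cat => /orP[/gt//|/(nthP 0)[i _ <-]].
  by rewrite -coef_map gQ.
- by apply: tht; rewrite mem_cat xt.
have hQ : map_poly h Q = Q.
  apply/polyP => i; rewrite coef_map /=.
  have [iQ|iQ] := ltnP i (size Q); last by rewrite nth_default // rmorph0.
  apply: (@gal_fixed_adjoin h 1%g theta) => //.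
  by apply: tht; rewrite mem_cat mem_nth ?orbT.
have : root Q (h eta).
  rewrite -hQ /root horner_map fmorph_eq0 /Q horner_prod.
  case: (e) e0 => // k _; rewrite big_ord_recl /=.
  by rewrite !hornerE subrr mul0r.
rewrite /root /Q horner_prod => /prodf_eq0[a _].
rewrite !hornerE subr_eq0 => /eqP ha; exists a => x xs.
exact: gal_fixed_adjoin (seta x xs) ha.
Qed.

(** [F] is an abstract copy of [K[theta]], the form in which extensions enter the hypothesis on
    local polynomials. The polynomial [p] of least degree vanishing at [theta] is separable because
    it divides [p0]. *)
Lemma exists_simple_extension theta :
  exists (F : fieldExtType K) (j : {rmorphism F -> L}),
    [/\ separable 1 {:F}, forall x : K, j (in_alg F x) = iota x &
        forall y, in_adjoin theta y <-> exists x, j x = y].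
Proof.
have [p0 sp0 rp0] := sepcl_separable hL theta.
pose P n := `[< exists p, [/\ p != 0, root (map_poly iota p) theta & size p = n] >].
have exP : exists n, P n.
  by exists (size p0); apply/asboolP; exists p0; split=> //; exact: separable_poly_neq0.
case: (ex_minnP exP) => n /asboolP[p [pn0 rp pn]] nmin.
have minp q : root (map_poly iota q) theta -> q != 0 -> (size p <= size q)%N.
  by move=> rq q0; rewrite pn; apply: nmin; apply/asboolP; exists q.
have irr : irreducible_poly p by apply/(subfx_irreducibleP rp pn0).
have pp0 : p %| p0.
  apply: contraT; rewrite /dvdp => m0.
  have := minp (p0 %% p); rewrite m0 leqNgt ltn_modp pn0 => /(_ _ isT); apply.
  have := rp0; rewrite {1}(divp_eq p0 p) rmorphD rmorphM /= /root !hornerE.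
  by rewrite (eqP rp) mulr0 add0r.
have sp := dvdp_separable pp0 sp0.
pose F := SubFieldExtType rp irr.
pose j : {rmorphism F -> L} := @subfx_inj K L iota theta p.
have jE r : j (subfx_eval iota theta p r) = (map_poly iota r).[theta].
  exact: subfx_inj_eval.
exists F, j; split.
- have -> : {:F}%VS = <<1; (subfx_root iota theta p : F)>>%VS.
    apply/vspaceP => x; rewrite memvf; apply/esym.
    have [r ->] := subfxEroot rp pn0 x.
    apply: mempx_Fadjoin; apply/polyOverP => i; rewrite coef_map.
    exact: rpredZ (mem1v _).
  rewrite -adjoin_separable_eq; apply/separable_elementP.
  exists (map_poly (in_alg F) p); split.
  + by apply/polyOverP => i; rewrite coef_map; exact: rpredZ (mem1v _).
  + rewrite -(fmorph_root j) -map_poly_comp (eq_map_poly (subfx_inj_base rp pn0)).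
    by rewrite [j _](subfx_inj_root rp pn0).
  + by rewrite separable_map.
- exact: subfx_inj_base rp pn0.
- move=> y; split=> [[r <-]|[x <-]]; first by exists (subfx_eval iota theta p r).
  by have [r ->] := subfxE x; exists r.
Qed.

End SeparableClosure.

(** * Extensions with a prescribed Frobenius element *)

(** The powers of a uniformizer have distinct valuations, so they cannot all be roots of one nonzero
    polynomial. *)
Lemma local_field_infinite (K : fieldType) (v : K -> int) (L : fieldType)
    (iota : {rmorphism K -> L}) : local_field v ->
  forall r : {poly L}, r != 0 -> exists t, ~~ root r (iota t).
Proof.
move=> hK r r0; apply: contrapT => none.
have [p p0 vp] := val_uniformizer hK.
have vpX k : v (p ^+ k) = k%:Z.
  elim: k => [|k IH]; first by rewrite expr0 (val1 hK).
  by rewrite exprS (Defs.valM hK) ?expf_neq0 // IH vp; lia.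
pose rs := mkseq (fun k => iota (p ^+ k)) (size r).
have rr : all (root r) rs.
  apply/allP => _ /mapP[k _ ->]; apply: contrapT => /negP nr.
  by apply: none; exists (p ^+ k).
have := max_poly_roots r0 rr; rewrite size_mkseq ltnn => /(_ _)/negP; case=> //.
apply: mkseq_uniq => a b /fmorph_inj /(congr1 v); rewrite !vpX => -[] //.
Qed.

(** For [r] the remainder of [a] by [e], the power [q ^ (d * r)] is congruent to 1 and, if [r > 0],
    lies strictly between 1 and the modulus. *)
Lemma expn_eq1_mod q d e a : (1 < q)%N -> (0 < d)%N -> (0 < e)%N ->
  q ^ (d * a) = 1 %[mod q ^ (d * e) - 1] -> (e %| a)%N.
Proof.
move=> q1 d0 e0 h; set N := (_ - 1)%N in h.
have N1 : (N + 1 = q ^ (d * e))%N by rewrite subnK ?expn_gt0 ?(ltnW q1).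
have qe : q ^ (d * e) = 1 %[mod N] by rewrite -N1 modnDl.
rewrite /dvdn; set r := (a %% e)%N.
have hr : q ^ (d * r) = 1 %[mod N].
  have qa : (q ^ (d * a) = (q ^ (d * e)) ^ (a %/ e) * q ^ (d * r))%N.
    by rewrite -expnM -expnD {1}(divn_eq a e) mulnDr -/r mulnA mulnAC.
  have qb : (q ^ (d * e)) ^ (a %/ e) = 1 %[mod N].
    by rewrite -modnXm qe modnXm exp1n.
  by rewrite -h qa -[RHS]modnMml qb modnMml mul1n.
have re : (r < e)%N by rewrite ltn_mod.
have [r0|r0] := posnP r; first exact/eqP.
have q2 : (2 <= q ^ (d * r))%N.
  by rewrite (leq_trans q1) // -{1}(expn1 q) leq_exp2l // muln_gt0 d0.
have qN : (q ^ (d * r) * 2 <= q ^ (d * e))%N.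
  apply: (@leq_trans (q ^ (d * r) * q)%N); first by rewrite leq_mul2l q1 orbT.
  rewrite -expnSr leq_exp2l //; apply: (@leq_trans (d * r.+1)%N).
    by rewrite mulnS addnC -addn1 leq_add2l.
  by rewrite leq_mul2l re orbT.
have xN : (q ^ (d * r) < N)%N.
  by clear -N1 q2 qN; move: (q ^ (d * r))%N (q ^ (d * e))%N N q2 qN N1 => x y M; lia.
have N2 : (1 < N)%N by apply: ltn_trans xN.
by move: hr q2; rewrite (modn_small xN) (modn_small N2) => ->.
Qed.

Section FiniteExtension.
Variables (K : fieldType) (v : K -> int).
Hypothesis hK : local_field v.
Variables (L : fieldType) (iota : {rmorphism K -> L}).
Hypothesis hL : separable_closure iota.

Local Notation OL := (integral_closure iota (integers v)).
Local Notation mL := (nonunits OL).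
Local Notation acts := (@acts_as_power _ v _ iota).

Lemma residue_class_preimP (F : fieldType) (j : {rmorphism F -> L}) x y :
  OL (j x) -> OL (j y) ->
  residue_class (j @^-1` OL)%classic x = residue_class (j @^-1` OL)%classic y <->
  mL (j x - j y).
Proof.
have mj z : nonunits (j @^-1` OL)%classic z <-> mL (j z).
  rewrite /nonunits /= fmorphV; split=> -[Oz h]; split=> //; case: h => h;
    [left|right|left|right] => //.
    by rewrite h rmorph0.
  by apply/eqP; rewrite -(fmorph_eq0 j) h.
move=> Ox Oy; split=> [h|h].
  have : residue_class (j @^-1` OL)%classic x x.
    by split=> //; apply/mj; rewrite subrr rmorph0; exact: nonunit0.
  by rewrite h => -[_ /mj]; rewrite rmorphB.
apply/seteqP; split=> z [Oz /mj hz]; split=> //; apply/mj; move: hz; rewrite !rmorphB /= => hz.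
  exact: nonunit_trans hz h.
by apply: nonunit_trans hz _ => //; exact: nonunit_sym.
Qed.

Lemma nonunit_prod (r : seq nat) (f : nat -> L) : (forall i, OL (f i)) ->
  mL (\prod_(i <- r) f i) -> exists2 i, i \in r & mL (f i).
Proof.
move=> Of; elim: r => [|i r IH]; first by rewrite big_nil => /(nonunit1 hK).
rewrite big_cons => /(nonunit_prime hK (Of i))[|mi|/IH[k kr mk]].
- by apply: (big_ind OL) => [|a b|k _] //; [exact: int_closure1|exact: (int_closureM hK)].
- by exists i; rewrite ?mem_head.
- by exists k => //; rewrite in_cons kr orbT.
Qed.

(** As [g] fixes [F], an integral [x] of [F] is congruent to [x ^+ Q]. Factoring [X ^ Q - X] over 0
    and the powers of [j x0], primality of the maximal ideal makes [x] congruent to one of these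
    roots, which remain distinct in the residue field by [unity_root_cong]. *)
Lemma fixed_field_residue_card (F : fieldType) (j : {rmorphism F -> L}) (g : galAut iota) Q x0 :
  (1 < Q)%N -> mL Q%:R -> acts Q g -> (forall x, g (j x) = j x) ->
  (Q - 1).-primitive_root (j x0) -> residue_card v iota j Q.
Proof.
move=> Q1 mQ gQ gj zp.
have mQ1 : ~ mL (Q - 1)%:R.
  rewrite natrB ?(ltnW Q1) // => /(nonunitB hK mQ); rewrite subKr; exact: nonunit1.
have Q10 : (0 < Q - 1)%N by rewrite subn_gt0.
have zX k : (j x0 ^+ k) ^+ (Q - 1) = 1 by rewrite exprAC (prim_expr_order zp) expr1n.
have OX k : OL (j (x0 ^+ k)).
  by rewrite rmorphXn; apply: (unity_root_int hK iota Q10); exact: zX.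
have O0 : OL (j 0) by rewrite rmorph0; exact: int_closure0.
(* Representatives of the [Q] classes: 0 first, then the powers of [x0] with indices shifted by
   one. *)
pose y i := if i is k.+1 then x0 ^+ k else 0.
have Oy i : OL (j (y i)) by case: i.
have nz k : ~ mL (j (x0 ^+ k)).
  rewrite rmorphXn => /(nonunitM hK (int_closureX hK (Q - 1).-1 (OX k))).
  by rewrite rmorphXn -exprSr prednK // zX; exact: nonunit1.
rewrite /residue_card card_eq_sym.
apply/card_set_bijP; exists (fun i => residue_class (j @^-1` OL)%classic (y i)).
split.
- by move=> i _; exists (y i) => //; exact: Oy.
- move=> a b; rewrite !inE /= => aQ bQ /(residue_class_preimP (Oy a) (Oy b)).
  case: a b aQ bQ => [|a] [|b] //= aQ bQ.
  + by rewrite rmorph0 sub0r => /(nonunitN hK); rewrite opprK => /nz.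
  + by rewrite rmorph0 subr0 => /nz.
  rewrite !rmorphXn => /(unity_root_cong hK Q10 mQ1 (zX a) (zX b))/eqP.
  rewrite (eq_prim_root_expr zp) !modn_small ?ltn_subRL ?add1n // => /eqP -> //.
move=> _ [x Ox <-].
have : mL (j x * \prod_(0 <= i < Q - 1) (j x - j x0 ^+ i)).
  have -> : \prod_(0 <= i < Q - 1) (j x - j x0 ^+ i) = j x ^+ (Q - 1) - 1.
    have := congr1 (horner^~ (j x)) (factor_Xn_sub_1 zp); rewrite horner_prod !hornerE => <-.
    by apply: eq_bigr => i _; rewrite !hornerE.
  rewrite mulrBr mulr1 -exprS subn1 prednK ?(ltnW Q1) //.
  by apply: (nonunit_sym hK); rewrite -{1}gj; exact: gQ.
have Oz i : OL (j x - j x0 ^+ i).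
  by apply: (int_closureB hK) => //; rewrite -rmorphXn; exact: OX.
move=> /(nonunit_prime hK Ox)[|mx|mp].
- by apply: (big_ind OL) => [|a b|i _] //; [exact: int_closure1|exact: (int_closureM hK)].
- exists 0%N; first by rewrite /= (ltnW Q1).
  by apply/(residue_class_preimP (Oy 0%N) Ox); rewrite rmorph0 sub0r; exact: (nonunitN hK).
have [k] := nonunit_prod Oz mp; rewrite mem_index_iota => /andP[_ kQ] mk.
exists k.+1; first by rewrite /= -(addn1 k) addnC -ltn_subRL.
apply/(residue_class_preimP (Oy k.+1) Ox); rewrite rmorphXn.
exact: (nonunit_sym hK).
Qed.

Lemma frobenius_extension (g : galAut iota) q d (s : seq L) :
  residue_card v iota iota q -> (0 < d)%N -> acts (q ^ d) g ->
  exists (F : fieldExtType K) (j : {rmorphism F -> L}),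
    [/\ separable 1 {:F}, forall x : K, j (in_alg F x) = iota x,
        frobenius v j g &
        forall h : galAut iota, inertia v j h -> {in s, h =1 id}].
Proof.
move=> qK d0 gq; have [q1 mq] := residue_card_gt1 hK qK.
have mqX f : (0 < f)%N -> mL (q ^ f)%:R.
  move=> f0; rewrite natrX -(prednK f0) exprSr; apply: (nonunitM hK) => //.
  exact: (int_closureX hK _ mq.1).
have mq1 f : (0 < f)%N -> ~ mL (q ^ f - 1)%:R.
  move=> f0; rewrite natrB ?expn_gt0 ?(ltnW q1) // => /(nonunitB hK (mqX f f0)).
  by rewrite subKr; exact: nonunit1.
have qX1 f : (0 < f)%N -> (1 < q ^ f)%N by move=> f0; rewrite -{1}(expn0 q) ltn_exp2l.
have [e e0 gs] := gal_periodic_seq hL g s.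
have de0 : (0 < d * e)%N by rewrite muln_gt0 d0.
pose N := (q ^ (d * e) - 1)%N.
have N0 : (0 < N)%N by rewrite subn_gt0 qX1.
have [|z zN] := exists_primitive_root hL N0.
  by apply/eqP => N00; apply: (mq1 _ de0); rewrite -/N N00; exact: nonunit0.
have dvN : (q ^ d - 1 %| N)%N.
  by rewrite /N expnM; apply/dvdnP; exists (\sum_(i < e) (q ^ d) ^ i)%N;
    rewrite !subn1 predn_exp mulnC.
(* The root of unity [z'] of order [q ^ d - 1] is put into [F] so that its residue field has all
   [q ^ d] elements. *)
have zd := dvdn_prim_root zN dvN; set z' := z ^+ _ in zd.
have d10 : (0 < q ^ d - 1)%N by rewrite subn_gt0 qX1.
have zd1 : z' ^+ (q ^ d - 1) = 1 := prim_expr_order zd.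
have Oz' : OL z' := unity_root_int hK iota d10 zd1.
(* [g z'] is congruent to [z' ^+ (q ^ d) = z'], and congruent roots of unity of this order are
   equal. *)
have gz' : g z' = z'.
  apply: (unity_root_cong hK d10 (mq1 d d0)) => //; first by rewrite -rmorphXn zd1 rmorph1.
  have zq : z' ^+ (q ^ d) = z' by rewrite -{1}(subnK (ltnW (qX1 d d0))) exprD zd1 mul1r.
  by have := gq z' Oz'; rewrite zq.
have gt x : x \in [:: z'] -> g x = x by rewrite inE => /eqP ->.
have [theta [gth thz thh]] := cyclic_fixed_field hL (local_field_infinite iota hK) (z :: s) gt.
have [F [j [sepF jK jth]]] := exists_simple_extension hL theta.
exists F, j; split=> //.
  have gj x : g (j x) = j x.
    have /jth jx : exists y, j y = j x by exists x.
    by apply: (@gal_fixed_adjoin _ _ iota g 1%g theta).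
  split=> //; exists (q ^ d)%N => //.
  have /jth[x0 x0z] := thz z' (mem_head _ _).
  apply: (fixed_field_residue_card (x0 := x0) (qX1 d d0) (mqX d d0) gq gj).
  by rewrite x0z.
move=> h [hj h1].
have hth : h theta = theta.
  have /jth[y <-] : in_adjoin iota theta theta by exists 'X; rewrite map_polyX hornerX.
  exact: hj.
have [a ha] := thh h hth.
have Oz : OL z by apply: (unity_root_int hK iota N0); exact: prim_expr_order zN.
(* On [z] the automorphism [h] agrees with [g ^+ a] and is trivial modulo the maximal ideal; again
   congruence of roots of unity is equality. *)
have zz : z ^+ (q ^ (d * a)) = z ^+ 1.
  have zk k : (z ^+ k) ^+ N = 1 by rewrite exprAC (prim_expr_order zN) expr1n.
  apply: (unity_root_cong hK N0 (mq1 _ de0)) => //.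
  apply: (nonunit_trans hK (y := h z)); last exact: h1.
  rewrite (ha z (mem_head _ _)); apply: (nonunit_sym hK).
  by rewrite expnM; apply: (actsX hK a gq).
have /dvdnP[b ab] : (e %| a)%N.
  apply: (@expn_eq1_mod q d) => //.
  by apply/eqP; rewrite -(eq_prim_root_expr zN); apply/eqP.
move=> x xs; rewrite ha ?in_cons ?xs ?orbT // ab mulnC.
by elim: b {ab} => [|b IH]; rewrite ?muln0 // mulnS expgD galM IH gs.
Qed.
End FiniteExtension.

(** * Weil representations *)

Section Diagonal.
Variable C : fieldType.

(** The inverse [P'] is a separate witness, so that factorisations of blocks are assembled without
    handling [invmx]. *)
Definition diag_factor n (M : 'M[C]_n) := exists (P P' : 'M[C]_n) (d : 'rV[C]_n),
  [/\ P *m P' = 1%:M, P' *m P = 1%:M & M = P' *m diag_mx d *m P].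

Lemma diagonalizable_factor n (M : 'M[C]_n) : diagonalizable M -> diag_factor M.
Proof.
move=> [P Pu /(diagonalizable_forLR Pu)[d ->]].
exists P, (invmx P), d; split; [exact: mulmxV|exact: mulVmx|].
by rewrite mxpoly.conjumx ?unitmx_inv // invmxK.
Qed.

Lemma diag_factorX n (M : 'M[C]_n) k : diag_factor M -> diag_factor (M ^+ k).
Proof.
move=> [P [P' [d [PP' P'P ->]]]]; exists P, P'.
suff [dk e] : exists dk, (P' *m diag_mx d *m P) ^+ k = P' *m diag_mx dk *m P.
  by exists dk.
elim: k => [|k [dk IH]].
  by exists (const_mx 1); rewrite expr0 diag_const_mx mulmx1 P'P.
eexists; rewrite exprS IH -mulmxE !mulmxA -(mulmxA _ P) PP' mulmx1.
by rewrite -(mulmxA P' (diag_mx d)) mulmx_diag.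
Qed.

Lemma diag_factor_inv n (M M' : 'M[C]_n) : M *m M' = 1%:M ->
  diag_factor M -> diag_factor M'.
Proof.
move=> MM' [P [P' [d [PP' P'P ME]]]]; exists P, P', (map_mx GRing.inv d); split=> //.
have dD : diag_mx d *m (P *m M' *m P') = 1%:M.
  have : P *m (M *m M') *m P' = 1%:M by rewrite MM' mulmx1 PP'.
  by rewrite ME !mulmxA PP' mul1mx.
have D0 i : d 0 i != 0.
  apply/eqP => di; have := congr1 (fun A : 'M_n => A i i) dD.
  by rewrite mul_diag_mx !mxE di mul0r eqxx => /esym/eqP; rewrite oner_eq0.
have -> : diag_mx (map_mx GRing.inv d) = P *m M' *m P'.
  rewrite -[RHS]mul1mx; have <- : diag_mx (map_mx GRing.inv d) *m diag_mx d = 1%:M.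
    rewrite mulmx_diag; apply/matrixP => i j; rewrite !mxE mulVf //.
  by rewrite -[RHS]mulmxA dD mulmx1.
by rewrite !mulmxA P'P mul1mx -mulmxA P'P mulmx1.
Qed.

Lemma diag_factor_block n n' (M : 'M[C]_n) (M' : 'M[C]_n') :
  diag_factor M -> diag_factor M' -> diag_factor (block_mx M 0 0 M').
Proof.
move=> [P [P' [d [PP' P'P ME]]]] [Q [Q' [d' [QQ' Q'Q ME']]]].
exists (block_mx P 0 0 Q), (block_mx P' 0 0 Q'), (row_mx d d').
rewrite !mulmx_block !(mul0mx, mulmx0, addr0, add0r) PP' QQ' P'P Q'Q.
split; rewrite -?scalar_mx_block //.
rewrite diag_mx_row !mulmx_block !(mul0mx, mulmx0, addr0, add0r).
by rewrite ME ME'.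
Qed.

End Diagonal.

Lemma seq_pigeonhole (T : eqType) (f : nat -> T) (s : seq T) :
  (forall i, f i \in s) -> exists i j, (i < j)%N /\ f i = f j.
Proof.
move=> fs; have : ~~ uniq (mkseq f (size s).+1).
  apply/negP => u; have := uniq_leq_size u (_ : {subset _ <= s}).
  by rewrite size_mkseq ltnn => /(_ _)/negP; apply=> // x /mapP[i _ ->].
move=> /(uniqPn (f 0%N))[i [j [ij]]]; rewrite size_mkseq => js.
rewrite !nth_mkseq // ?(ltn_trans ij) // => fij.
by exists i, j.
Qed.

Section WeilRepresentation.
Variables (R : realType) (K : fieldType) (v : K -> int).
Hypothesis hK : local_field v.
Variables (L : fieldType) (iota : {rmorphism K -> L}).
Local Notation G := (galAut iota).
Local Notation C := (R[i]).
Local Notation acts := (@acts_as_power _ v _ iota).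

Variable q : nat.
Hypothesis qK : residue_card v iota iota q.

Lemma weilE (g : G) :
  weil v iota g <-> exists k, acts (q ^ k) g \/ acts (q ^ k) (g^-1)%g.
Proof.
split=> [[_ [q' q'K [k h]]]|[k h]].
  by exists k; rewrite (residue_card_uniq qK q'K).
by split=> [x|]; [exact: gal_iota|exists q => //; exists k].
Qed.

Lemma weil_inertia (g : G) : inertia v iota g -> weil v iota g.
Proof. by move=> [_ g1]; apply/weilE; exists 0%N; left. Qed.

Lemma inertiaE (g : G) : inertia v iota g <-> acts 1 g.
Proof. by split=> [[]|g1] //; split=> // x; exact: gal_iota. Qed.

Lemma weil_acts k (g : G) : acts (q ^ k) g -> weil v iota g.
Proof. by move=> gk; apply/weilE; exists k; left. Qed.

Lemma weilV (g : G) : weil v iota g -> weil v iota (g^-1)%g.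
Proof. by move=> /weilE[k h]; apply/weilE; exists k; rewrite invgK or_comm. Qed.

Lemma weil1 : weil v iota (1%g : G).
Proof. by apply: (@weil_acts 0); exact: acts1. Qed.

(** When the exponents have opposite signs, the smaller one is divided out of the larger, after
    passing to the inverse of the product if necessary. *)
Lemma weilM (g h : G) : weil v iota g -> weil v iota h -> weil v iota (g * h)%g.
Proof.
have mixed a b g' h' : acts (q ^ a) g' -> acts (q ^ b) (h'^-1)%g ->
    weil v iota (g' * h')%g.
  move=> ag bh; rewrite -(invgK h'); have [ba|/ltnW ab] := leqP b a.
    apply: (@weil_acts (a - b)); apply: (acts_divr hK) bh.
    by rewrite -expnD subnKC.
  rewrite -[X in weil _ _ X]invgK invgM invgK; apply/weilV/(@weil_acts (b - a)).
  by apply: (acts_divr hK) ag; rewrite -expnD subnKC.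
have mixed' a b g' h' : acts (q ^ a) (g'^-1)%g -> acts (q ^ b) h' ->
    weil v iota (g' * h')%g.
  move=> ag bh; rewrite -(invgK g'); have [ba|/ltnW ab] := leqP a b.
    apply: (@weil_acts (b - a)); apply: (acts_divl hK) ag.
    by rewrite -expnD subnK.
  rewrite -[X in weil _ _ X]invgK invgM invgK; apply/weilV/(@weil_acts (a - b)).
  by apply: (acts_divl hK) bh; rewrite -expnD subnK.
move=> /weilE[a [ag|ag]] /weilE[b [bh|bh]].
- by apply: (@weil_acts (a + b)); rewrite expnD; exact: actsM.
- exact: mixed ag bh.
- exact: mixed' ag bh.
rewrite -[X in weil _ _ X]invgK invgM; apply/weilV/(@weil_acts (b + a)).
by rewrite expnD; exact: actsM.
Qed.

Lemma repr_weilM n (rho : G -> 'M[C]_n) g h : weil_repr v rho ->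
  weil v iota g -> weil v iota h -> rho (g * h)%g = rho g *m rho h.
Proof. by move=> rr Wg Wh; apply: (weil_reprM rr); rewrite inE. Qed.

Lemma repr_weilV n (rho : G -> 'M[C]_n) g : weil_repr v rho ->
  weil v iota g -> rho g *m rho (g^-1)%g = 1%:M.
Proof.
move=> rr Wg; rewrite -(repr_weilM rr Wg (weilV Wg)) mulgV; exact: weil_repr1 rr.
Qed.

Lemma repr_weilX n (rho : G -> 'M[C]_n) g k : weil_repr v rho ->
  weil v iota g -> weil v iota (g ^+ k)%g /\ rho (g ^+ k)%g = rho g ^+ k.
Proof.
move=> rr Wg; elim: k => [|k [Wk IH]]; first by split; [exact: weil1|exact: weil_repr1 rr].
by rewrite expgS; split; [exact: weilM|rewrite (repr_weilM rr Wg Wk) IH exprS].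
Qed.

(* The elements [phi1 ^- k * phi2 ^ k] are in the inertia group, which has a
   finite image. *)
Lemma frobenius_powers_agree n (rho : G -> 'M[C]_n) (phi1 phi2 : G) : weil_repr v rho ->
  acts q phi1 -> acts q phi2 -> exists2 m, (0 < m)%N & rho phi1 ^+ m = rho phi2 ^+ m.
Proof.
move=> rr a1 a2; have [S SE] := (finite_seqP _).1 (weil_repr_inertia rr).
have W1 : weil v iota phi1 by apply: (@weil_acts 1); rewrite expn1.
have W2 : weil v iota phi2 by apply: (@weil_acts 1); rewrite expn1.
pose f k := rho ((phi1 ^+ k)^-1 * phi2 ^+ k)%g.
have fS k : f k \in S.
  have : (rho @` inertia v iota)%classic (f k); last by rewrite SE.
  exists ((phi1 ^+ k)^-1 * phi2 ^+ k)%g => //; apply/inertiaE.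
  by apply: (acts_divl hK) (actsX hK k a1); rewrite mul1n; exact: actsX.
have [k [l [kl fkl]]] := seq_pigeonhole fS.
have WX1 i := repr_weilX i rr W1; have WX2 i := repr_weilX i rr W2.
have rf i : rho phi1 ^+ i *m f i = rho phi2 ^+ i.
  rewrite -(WX1 i).2 /f -(repr_weilM rr (WX1 i).1); last first.
    by apply: weilM; [exact/weilV/(WX1 i).1|exact: (WX2 i).1].
  by rewrite mulKVg (WX2 i).2.
exists (l - k)%N; first by rewrite subn_gt0.
have u2 := repr_weilV rr (WX2 k).1; rewrite (WX2 k).2 in u2.
(* By [rf], the left side is [rho phi1 ^+ l *m f k], and [f k = f l] turns it into
   [rho phi2 ^+ l]. *)
have e : rho phi1 ^+ (l - k) * rho phi2 ^+ k = rho phi2 ^+ (l - k) * rho phi2 ^+ k.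
  by rewrite -{1}(rf k) -!exprD subnK ?(ltnW kl) // -(rf l) -fkl -mulmxE mulmxA mulmxE -exprD
    subnK ?(ltnW kl).
move: e u2; move: (rho phi1 ^+ _) (rho phi2 ^+ (l - k)) (rho phi2 ^+ k) => A B D e u2.
by rewrite -[A]mulmx1 -[B]mulmx1 -u2 !mulmxA; congr (_ *m _).
Qed.

(** A finite image is discrete: some [eps] separates 1 from its other elements, and continuity at 1
    for this [eps] provides [s]. *)
Lemma weil_repr_kernel n (rho : G -> 'M[C]_n) : weil_repr v rho ->
  exists s : seq L, forall h, inertia v iota h -> {in s, h =1 id} -> rho h = 1%:M.
Proof.
move=> rr; have [S SE] := (finite_seqP _).1 (weil_repr_inertia rr).
have [eps eps0 heps] : exists2 eps : R, 0 < eps & forall M : 'M[C]_n, M \in S ->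
    (forall a b, `|M a b - (1%:M : 'M[C]_n) a b| < eps%:C) -> M = 1%:M.
  elim: S {SE} => [|M S [eps eps0 IH]]; first by exists 1.
  have [->|M1] := eqVneq M 1%:M.
    by exists eps => // M'; rewrite in_cons => /predU1P[->//|]; exact: IH.
  have [a [b ab]] : exists a b, M a b != (1%:M : 'M[C]_n) a b.
    apply: contrapT => h; move: M1 => /eqP; apply; apply/matrixP => a b.
    by apply: contrapT => /eqP ab; apply: h; exists a, b.
  (* The norm takes its values in [C]; as this value is real, [Re] brings it down to [R]. *)
  pose e := Num.min eps (complex.Re `|M a b - (1%:M : 'M[C]_n) a b|).
  have nr : (complex.Re `|M a b - (1%:M : 'M[C]_n) a b|)%:C = `|M a b - (1%:M : 'M[C]_n) a b|.
    by rewrite RRe_real // ger0_real.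
  exists e.
    by rewrite lt_min eps0 /= -ltcR nr normr_gt0 subr_eq0.
  move=> M'; rewrite in_cons => /predU1P[->|M'S] h.
    have := h a b; rewrite -nr ltcR /e lt_min ltxx andbF //.
  apply: IH => // a' b'; apply: lt_le_trans (h a' b') _.
  by rewrite lecR /e ge_min lexx.
have [s hs] : exists s : seq L, forall h, inertia v iota h -> {in s, h =1 id} ->
    forall a b, `|rho (1 * h)%g a b - rho 1%g a b| < eps%:C.
  by apply: (weil_repr_continuous rr) => //; exact: weil1.
exists s => h Ih fixh; apply: heps => [|a b].
  by have : (rho @` inertia v iota)%classic (rho h) by [exists h]; rewrite SE.
by have := hs h Ih fixh a b; rewrite mul1g (weil_repr1 rr).
Qed.

(** When inertia acts trivially the invariants are the whole space. The Frobenius element selected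
    by [xget] differs from [g] by an element of inertia, so both have the same image. *)
Lemma mxtrace_local_poly n (rho : G -> 'M[C]_n) (F : fieldType)
    (j : {rmorphism F -> L}) (g : G) : weil_repr v rho ->
  weil v iota g -> frobenius v j g -> (forall h, inertia v j h -> rho h = 1%:M) ->
  (local_poly v rho j)`_1 = - \tr (rho (g^-1)%g).
Proof.
move=> rr Wg [gj [Q QF gQ]] trivial_inertia; rewrite /local_poly.
set phi := xget _ _.
have [phij [Q' Q'F phiQ]] : frobenius v j phi.
  by apply: xgetPex; exists g; split=> //; exists Q.
rewrite (residue_card_uniq Q'F QF) in phiQ.
have Iu : inertia v j (phi^-1 * g)%g.
  split=> [x|]; last by apply: (acts_divl hK) phiQ; rewrite mul1n.
  by rewrite galM gj -[in LHS](phij x) galK.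
have -> : rho (phi^-1)%g = rho (g^-1)%g.
  have Wu : weil v iota (phi^-1 * g)%g by apply/weil_inertia/inertiaE; exact: Iu.2.
  by rewrite -[(phi^-1)%g](mulgK g) (repr_weilM rr Wu (weilV Wg)) trivial_inertia ?mul1mx.
rewrite coef1_det_linear mxtrace_restr_mx //.
apply/vspaceP => w; rewrite memvf; apply/fixed_spaceP => h Ih.
by rewrite trivial_inertia ?mul1mx.
Qed.

End WeilRepresentation.

Lemma mxtrace_inverse_eq (R : realType) (K : fieldType) (v : K -> int)
    (hK : local_field v)
    (L : fieldType) (iota : {rmorphism K -> L}) (hL : separable_closure iota)
    q (qK : residue_card v iota iota q) (n n' : nat)
    (rho : galAut iota -> 'M[R[i]]_n) (rho' : galAut iota -> 'M[R[i]]_n') :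
  weil_repr v rho -> weil_repr v rho' ->
  (forall (F : fieldExtType K) (j : {rmorphism F -> L}),
     separable 1 {:F} -> (forall x : K, j (in_alg F x) = iota x) ->
     local_poly v rho j = local_poly v rho' j) ->
  forall k g, (0 < k)%N -> acts_as_power v (q ^ k) g ->
    \tr (rho (g^-1)%g) = \tr (rho' (g^-1)%g).
Proof.
move=> hrho hrho' hP k g k0 gk; have Wg := weil_acts qK gk.
have [s hs] := weil_repr_kernel hK qK hrho.
have [s' hs'] := weil_repr_kernel hK qK hrho'.
(* Taking [s ++ s'] yields one field whose inertia group is killed by both representations. *)
have [F [j [sepF jK gF IF]]] := frobenius_extension hK hL (s ++ s') qK k0 gk.
have II (h : galAut iota) : inertia v j h -> inertia v iota h.
  by move=> [_ h1]; split=> // x; exact: gal_iota.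
apply: oppr_inj; rewrite -(mxtrace_local_poly hK qK hrho Wg gF); last first.
  by move=> h Ih; apply: hs; [exact: II|move=> x xs; apply: IF Ih _ _; rewrite mem_cat xs].
rewrite -(mxtrace_local_poly hK qK hrho' Wg gF) ?hP // => h Ih.
by apply: hs'; [exact: II|move=> x xs; apply: IF Ih _ _; rewrite mem_cat xs orbT].
Qed.

Theorem theorem2p1 (R : realType) (K : fieldType) (v : K -> int)
  (hK : local_field v)
  (L : fieldType) (iota : {rmorphism K -> L}) (hL : separable_closure iota)
  (n n' : nat) (rho : galAut iota -> 'M[R[i]]_n) (rho' : galAut iota -> 'M[R[i]]_n')
  (hrho : weil_repr v rho) (hss : frobenius_semisimple v rho)
  (hrho' : weil_repr v rho') (hss' : frobenius_semisimple v rho')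
  (hP : forall (F : fieldExtType K) (j : {rmorphism F -> L}),
     separable 1 {:F} -> (forall x : K, j (in_alg F x) = iota x) ->
     local_poly v rho j = local_poly v rho' j) :
  weil_iso v rho rho'.
Proof.
have [phi1 [_ [q qK a1]] diag1] := hss.
have [phi [_ [q' q'K a]] diag'] := hss'.
move: a; rewrite -(residue_card_uniq qK q'K) => a {q' q'K}.
have trE := mxtrace_inverse_eq hK hL qK hrho hrho' hP.
(* The two semisimplicity hypotheses concern different Frobenius elements; a common power under
   [rho] allows [phi] to serve for both. *)
have [m m0 phi1m] := frobenius_powers_agree hK qK hrho a1 a.
have Wphi : weil v iota phi by apply: (weil_acts qK (k := 1)); rewrite expn1.
have Wi g : inertia v iota g -> weil v iota g := weil_inertia qK (g := g).
have WM := weilM hK qK.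
have WV := weilV qK.
have rM := repr_weilM hrho; have rM' := repr_weilM hrho'.
(* The direct sum of the two representations; [p] and [p'] below project onto its summands, and [U]
   is the finite image of inertia. *)
pose sg (g : galAut iota) : 'M[R[i]]_(n + n') := block_mx (rho g) 0 0 (rho' g).
have sg1 : sg 1%g = 1 by rewrite /sg (weil_repr1 hrho) (weil_repr1 hrho') -scalar_mx_block.
have sgM g h : weil v iota g -> weil v iota h -> sg (g * h)%g = sg g * sg h.
  move=> Wg Wh; rewrite -mulmxE /sg mulmx_block !(mul0mx, mulmx0, addr0, add0r).
  by rewrite rM ?rM'.
have sgV g : weil v iota g -> sg g * sg (g^-1)%g = 1.
  by move=> Wg; rewrite -sgM ?mulgV //; exact: WV.
have sgVl g : weil v iota g -> sg (g^-1)%g * sg g = 1.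
  by move=> Wg; rewrite -sgM ?mulVg //; exact: WV.
have [U UE] : exists U : seq 'M[R[i]]_(n + n'), (sg @` inertia v iota = [set` U])%classic.
  apply/finite_seqP; apply: sub_finite_set (finite_image2
    (fun A B => block_mx A 0 0 B) (weil_repr_inertia hrho) (weil_repr_inertia hrho')).
  by move=> _ [g Ig <-]; exists (rho g); [exists g|exists (rho' g); [exists g|]].
have UP u : u \in U <-> exists2 g, inertia v iota g & sg g = u.
  by have := congr1 (fun A => A u) UE => /= <-.
have IE (g : galAut iota) : inertia v iota g <-> acts_as_power v 1 g by exact: inertiaE.
have Wphi' := WV _ Wphi.
pose p : 'M[R[i]]_(n + n') := block_mx 1%:M 0 0 0.
pose p' : 'M[R[i]]_(n + n') := block_mx 0 0 0 1%:M.
have blockE := (mulmx_block, mul0mx, mulmx0, mulmx1, mul1mx, addr0, add0r).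
have sgp g : sg g * p = p * sg g by rewrite -!mulmxE /sg /p !blockE.
have sgp' g : sg g * p' = p' * sg g by rewrite -!mulmxE /sg /p' !blockE.
have pp : p * p = p by rewrite -mulmxE /p !blockE.
have pp' : p' * p' = p' by rewrite -mulmxE /p' !blockE.
have sgX k : sg (phi^-1)%g ^+ k = sg ((phi ^+ k)^-1)%g /\ weil v iota (phi ^+ k)%g.
  elim: k => [|k [IH Wk]]; first by rewrite invg1 sg1; split=> //; exact: (weil1 hK qK).
  split; last by rewrite expgS; exact: WM.
  by rewrite exprS IH -sgM ?expgSr ?invgM //; exact: WV.
(* The averaging is applied with [Phi = sg (phi^-1)], because traces are known on inverses of
   elements acting as positive powers of Frobenius. On the first block [phi1m] replaces [phi] by
   [phi1]. *)
have [P [P' [d [PP' P'P sgm]]]] : diag_factor (sg (phi^-1)%g ^+ m).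
  have [-> Wm] := sgX m; apply: diag_factor_block.
    apply: (diag_factor_inv (repr_weilV qK hrho Wm)).
    rewrite (repr_weilX hK qK m hrho Wphi).2 -phi1m.
    exact/diag_factorX/diagonalizable_factor.
  apply: (diag_factor_inv (repr_weilV qK hrho' Wm)).
  rewrite (repr_weilX hK qK m hrho' Wphi).2.
  exact/diag_factorX/diagonalizable_factor.
have U1 : 1 \in U by apply/UP; exists 1%g => //; apply/IE; exact: acts1.
have UM u w : u \in U -> w \in U -> u * w \in U.
  move=> /UP[g /[dup] Ig /IE g1 <-] /UP[h /[dup] Ih /IE h1 <-].
  rewrite -sgM; [|exact: Wi|exact: Wi]; apply/UP; exists (g * h)%g => //.
  by apply/IE; rewrite -[1%N]muln1; exact: actsM.
have UV u : u \in U -> exists2 w, w \in U & u * w = 1 /\ w * u = 1.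
  move=> /UP[g /[dup] /Wi Wg /IE g1 <-]; exists (sg (g^-1)%g).
    by apply/UP; exists (g^-1)%g => //; apply/IE; exact: actsV1.
  by rewrite sgV ?sgVl.
have UJ u : u \in U -> sg (phi^-1)%g * u * sg phi \in U.
  move=> /UP[g /[dup] /Wi Wg /IE g1 <-].
  rewrite -sgM // -sgM //; last exact: WM; apply/UP; exists (phi^-1 * g * phi)%g => //.
  apply/IE; rewrite -mulgA; exact: (acts_divl hK (actsM hK g1 a) a).
have tr_pp' k u : (0 < k)%N -> u \in U ->
    \tr (sg (phi^-1)%g ^+ k * u * p) = \tr (sg (phi^-1)%g ^+ k * u * p').
  move=> k0 /UP[g /[dup] /Wi Wg /IE g1 <-]; have [-> Wk] := sgX k.
  rewrite -sgM //; last exact: WV.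
  rewrite -!mulmxE /sg /p /p' !blockE !mxtrace_block !mxtrace0 addr0 add0r.
  (* The element [g^-1 * phi ^+ k] acts with exponent [q ^ k], so [trE] covers its inverse. *)
  have -> : ((phi ^+ k)^-1 * g = (g^-1 * phi ^+ k)^-1)%g by rewrite invgM invgK.
  apply: (trE k) => //; apply: (acts_divl hK) g1.
  by rewrite muln1; exact: actsX.
have Up : {in U, forall u, u * p = p * u} by move=> u /UP[g _ <-].
have Up' : {in U, forall u, u * p' = p' * u} by move=> u /UP[g _ <-].
have [T [T' [[phiT _] UT TT' T'T [pT pT']]]] :=
  finite_by_cyclic_equiv (sgVl _ Wphi) (sgV _ Wphi) U1 UM UV UJ m0 PP' P'P sgm pp pp'
    (sgp _) (sgp' _) Up Up' tr_pp'.
(* [T = p T p'] leaves only the upper right block, which is the isomorphism sought; [T'] likewise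
   contains its inverse. *)
have TE : T = block_mx 0 (ursubmx T) 0 0.
  by rewrite -[LHS]pT -{1}(submxK T) -!mulmxE /p /p' !blockE.
have T'E : T' = block_mx 0 0 (dlsubmx T') 0.
  by rewrite -[LHS]pT' -{1}(submxK T') -!mulmxE /p /p' !blockE.
move: (ursubmx T) (dlsubmx T') TE T'E => A B TE T'E.
have [AB BA] : A *m B = 1%:M /\ B *m A = 1%:M.
  move: TT' T'T; rewrite TE T'E -!mulmxE !blockE /p /p'.
  by move=> /eq_block_mx[-> _ _ _] /eq_block_mx[_ _ _ ->].
(* It remains to extend the intertwining relation from inertia and [phi^-1] to the whole Weil
   group. *)
have interM g h : weil v iota g -> weil v iota h -> rho g *m A = A *m rho' g ->
    rho h *m A = A *m rho' h -> rho (g * h)%g *m A = A *m rho' (g * h)%g.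
  by move=> Wg Wh gA hA; rewrite rM ?rM' // -mulmxA hA mulmxA gA mulmxA.
have interV g : weil v iota g -> rho g *m A = A *m rho' g ->
    rho (g^-1)%g *m A = A *m rho' (g^-1)%g.
  move=> Wg gA; rewrite -[LHS]mulmx1 -(repr_weilV qK hrho' Wg) mulmxA -(mulmxA _ A) -gA.
  by rewrite mulmxA -rM ?mulVg ?(weil_repr1 hrho) ?mul1mx //; exact: WV.
have inter_sg g : sg g * T = T * sg g -> rho g *m A = A *m rho' g.
  by rewrite TE -!mulmxE /sg !blockE => /eq_block_mx[_ -> _ _].
have interI g : inertia v iota g -> rho g *m A = A *m rho' g.
  by move=> Ig; apply: inter_sg; have [] := UT (sg g) _; first by apply/UP; exists g.
have inter_phi k : rho (phi ^+ k)%g *m A = A *m rho' (phi ^+ k)%g.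
  elim: k => [|k IH]; first by rewrite (weil_repr1 hrho) (weil_repr1 hrho') mul1mx mulmx1.
  rewrite expgS; apply: interM => //; first exact: (sgX k).2.
  by rewrite -(invgK phi); apply: interV => //; exact: inter_sg.
have inter_acts k g : acts_as_power v (q ^ k) g -> rho g *m A = A *m rho' g.
  move=> gk; have Wk := (sgX k).2; rewrite -(mulKVg (phi ^+ k)%g g).
  have Ig : inertia v iota ((phi ^+ k)^-1 * g)%g.
    by apply/IE/(acts_divl hK _ (actsX hK k a)); rewrite mul1n.
  by apply: interM => //; [exact: Wi|exact: interI].
exists A, B; split=> // g /(weilE qK)[k [gk|gk]]; first exact: (inter_acts _ _ gk).
rewrite -(invgK g); apply: interV; first exact: (weil_acts qK gk).
exact: (inter_acts _ _ gk).
Qed.
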